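(* Let $\omega\in\mathbb{R}^{n+1}$ be a fixed unit vector and let $\mathbf{F}:M^n\times[0,T]\to\mathbb{R}^{n+1}$ be a smooth, entire solution of mean curvature flow $$\frac{d}{dt}\mathbf{F}(p,t)=\mathbf{H}(p,t)$$ which is a periodic graph over the hyperplane orthogonal to $\omega$, in that $u(y,t)=u(y+L,t)$ for a fixed point $L$ in the hyperplane, and has a height bound $|u|<M$. Then $$v\le t^{1/2}\exp\!\left(\frac{c(|u|-2M)^2}{4t}\right)$$ for $0<t\le T'$ (with $t\le T$), where $c>0$ and $T'>0$ depend only on $M$.
   Context: $\mathbf{H}$ is the mean curvature vector. For the image point $\mathbf{x}=\mathbf{F}(p,t)$, the height is $u=\langle\mathbf{x},\omega\rangle$ (regarded as a function of the position $y$ in the hyperplane orthogonal to $\omega$), and the gradient function is $v=\langle\nu,\omega\rangle^{-1}=\sqrt{1+|Du|^2}$, where $\nu$ is the unit normal with $\langle\nu,\omega\rangle>0$. *)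

(* Defs.v *)
From HB Require Import structures.
From mathcomp Require Import all_boot all_order all_algebra.
From mathcomp Require Import all_classical all_reals all_analysis.
Import Order.TTheory GRing.Theory Num.Theory numFieldNormedType.Exports.

Set Implicit Arguments.
Unset Strict Implicit.
Unset Printing Implicit Defensive.

Local Open Scope classical_set_scope.
Local Open Scope ring_scope.

(* The library's norm on row vectors is the sup norm; it is used here only for
   the topology.  Euclidean lengths and angles are measured with [dot]. *)
Definition dot (R : realType) (m : nat) (a b : 'rV[R]_m) : R :=
  \sum_(i < m) a 0 i * b 0 i.

Definition hyperplane (R : realType) (m : nat) (w : 'rV[R]_m) : set 'rV[R]_m :=
  [set y | dot y w = 0].

(* Meaningful for open O, where 'D_v f on O depends only on f restricted to O. *)
Fixpoint Ck (R : realType) (V W : normedModType R) (k : nat)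
    (O : set V) (f : V -> W) : Prop :=
  match k with
  | 0%N => forall x, O x -> {for x, continuous f}
  | k'.+1 => (forall x, O x -> differentiable f x) /\
             (forall v : V, Ck k' O (fun x => 'D_v f x))
  end.

(* C^oo on an arbitrary subset, e.g. a product with the closed interval [0, T]:
   near each point of A, f agrees on A with a C^oo function on an open set. *)
Definition smooth_on (R : realType) (V W : normedModType R)
    (A : set V) (f : V -> W) : Prop :=
  forall x, A x -> exists (O : set V) (g : V -> W),
    [/\ open O, O x, (forall k, Ck k O g)
      & forall y, A y -> O y -> g y = f y].

Record smooth_manifold (R : realType) (n : nat) (X : topologicalType) :=
  SmoothManifold {
    chart_index : Type;
    chart_dom : chart_index -> set X;
    chart : chart_index -> X -> 'rV[R]_n;
    (* meaningful only on the image of the chart domain *)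
    chart_inv : chart_index -> 'rV[R]_n -> X;
    manifold_hausdorff : hausdorff_space X;
    manifold_second_countable : @second_countable X;
    chart_dom_open : forall i, open (chart_dom i);
    chart_dom_cover : forall p, exists i, chart_dom i p;
    chart_img_open : forall i, open (chart i @` chart_dom i);
    chartK : forall i p, chart_dom i p -> chart_inv i (chart i p) = p;
    chart_continuous : forall i p,
      chart_dom i p -> {for p, continuous (chart i)};
    chart_inv_continuous : forall i x,
      (chart i @` chart_dom i) x -> {for x, continuous (chart_inv i)};
    chart_transition_smooth : forall i j,
      smooth_on (chart i @` (chart_dom i `&` chart_dom j))
                (fun x => chart j (chart_inv i x)) }.

Section ParametrizedHypersurface.
Context (R : realType) (n : nat).
Implicit Types (X : 'rV[R]_n -> 'rV[R]_n.+1) (x : 'rV[R]_n).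

Definition partial (W : normedModType R) (i : 'I_n) (f : 'rV[R]_n -> W) x : W :=
  'D_(delta_mx 0 i) f x.

(* The rows of [jacobian X x] are the coordinate tangent vectors of X at x. *)
Definition metric X x : 'M[R]_n := jacobian X x *m (jacobian X x)^T.

Definition normal_part X x (a : 'rV[R]_n.+1) : 'rV[R]_n.+1 :=
  a - a *m (jacobian X x)^T *m invmx (metric X x) *m jacobian X x.

(* H = g^{ij} (d_i d_j X)^perp, the trace of the vector-valued second
   fundamental form; it points inwards on a sphere. *)
Definition mean_curvature_vector X x : 'rV[R]_n.+1 :=
  \sum_(i < n) \sum_(j < n)
    invmx (metric X x) i j *: normal_part X x (partial i (partial j X) x).

End ParametrizedHypersurface.

Section MeanCurvatureFlow.
Context (R : realType) (n : nat) (X : topologicalType).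
Variable A : smooth_manifold R n X.
Implicit Types (F : X -> R -> 'rV[R]_n.+1) (T t : R) (p : X).

Definition local_param F (i : chart_index A) t : 'rV[R]_n -> 'rV[R]_n.+1 :=
  fun x => F (chart_inv i x) t.

Definition mean_curvature_flow T F : Prop :=
  [/\ forall i : chart_index A,
        smooth_on [set xt : 'rV[R]_n * R |
                     (chart i @` chart_dom i) xt.1 /\ 0 <= xt.2 <= T]
                  (fun xt => local_param F i xt.2 xt.1),
      forall (i : chart_index A) p t, chart_dom i p -> 0 <= t <= T ->
        row_free (jacobian (local_param F i t) (chart i p))
    & (* the time derivative is one-sided at t = 0 and t = T *)
      forall (i : chart_index A) p t, chart_dom i p -> 0 <= t <= T ->
        (s - t)^-1 *: (F p s - F p t) @[s --> within `[0, T] t^'] -->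
          mean_curvature_vector (local_param F i t) (chart i p)].

(* Each F(X, t) is the graph of u(., t) over the whole hyperplane orthogonal
   to w; only the values of u at y in that hyperplane, t in [0, T], matter. *)
Definition entire_graph (w : 'rV[R]_n.+1) T F (u : 'rV[R]_n.+1 -> R -> R) :
    Prop :=
  smooth_on [set yt : 'rV[R]_n.+1 * R | hyperplane w yt.1 /\ 0 <= yt.2 <= T]
            (fun yt => (u yt.1 yt.2 : R^o)) /\
  (forall t, 0 <= t <= T ->
     range (fun p => F p t) = [set y + u y t *: w | y in hyperplane w]).

(* Given dot w w = 1 and that the hypersurface is nowhere vertical, there is
   exactly one such nu. *)
Definition upward_unit_normal (w : 'rV[R]_n.+1) F p t (nu : 'rV[R]_n.+1) :
    Prop :=
  [/\ dot nu nu = 1, 0 < dot nu w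
    & forall (i : chart_index A) (k : 'I_n), chart_dom i p ->
        dot nu (partial k (local_param F i t) (chart i p)) = 0].

End MeanCurvatureFlow.

Definition periodic_height (R : realType) (m : nat) (w : 'rV[R]_m) (T : R)
    (u : 'rV[R]_m -> R -> R) (L : 'rV[R]_m) : Prop :=
  [/\ hyperplane w L, L != 0
    & forall y t, hyperplane w y -> 0 <= t <= T -> u y t = u (y + L) t].

(* Main.v *)
(* The hypersurface is the graph of a function u(., t) over the hyperplane
   orthogonal to w; extended to be constant in the direction w, u solves
   u_t = sum_ij (delta_ij - N_i N_j / |N|^2) u_ij with N = w - Du, |N| = v.
   Let L = d_t - sum_ij a_ij d_i d_j, where the coefficients a_ij are those of
   the equation, frozen at a point.  There L u = 0, while the function l = <N0, N>, N0 the value of N at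
   that point, satisfies L l = - (2 / l) |Dl|^2, the gradient being measured in
   the induced metric.  Since l <= |N0| v, with equality at the point, at a
   maximum of v eta with eta > 0 the product l eta is maximal too, and there
   L (l eta) = l L eta; hence L eta >= 0 at that point.

   Fix t1 <= 6 M^2.  The function
     eta = exp (La (ka t + u - M)) - 1 - ep (|y|^2 + 2 m t),
   with ka = 3 M / t1 and La = 2 ka, has L eta < 0 wherever v > sqrt 2, is
   negative at t = 0 and outside a compact set, and is at most
   exp (18 M^2 / t1).  Letting ep tend to 0 gives
   v (., t1) <= 2 exp (18 M^2 / t1).  No compactness of the hypersurface is
   needed (the periodicity is in a single direction only), and the constants do
   not depend on the dimension. *)
Require Import Defs.
From HB Require Import structures.
From mathcomp Require Import all_boot all_order all_algebra.
From mathcomp Require Import all_classical all_reals all_analysis.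
From mathcomp Require Import ring lra.
Import Order.TTheory GRing.Theory Num.Theory numFieldNormedType.Exports.

Set Implicit Arguments.
Unset Strict Implicit.
Unset Printing Implicit Defensive.

Local Open Scope classical_set_scope.
Local Open Scope ring_scope.

(** * Directional derivatives and symmetry of second derivatives *)

Section DirectionalDerivatives.
Context (R : realType) (V W : normedModType R).
Implicit Types (f : V -> W) (x v w : V).

Lemma is_derive_diff f x v : differentiable f x -> is_derive x v f ('D_v f x).
Proof. by move=> /diff_derivable df; exact/derivableP. Qed.

Lemma derive_dirD f x v w :
  differentiable f x -> 'D_(v + w) f x = 'D_v f x + 'D_w f x.
Proof. by move=> df; rewrite !deriveE// linearD. Qed.

Lemma derive_dirZ f x a v : differentiable f x -> 'D_(a *: v) f x = a *: 'D_v f x.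
Proof. by move=> df; rewrite !deriveE// linearZ. Qed.

(** The inner map need only be derivable in the direction [u]: along the line through [y] it is a
    function of one real variable, for which derivable and differentiable coincide. *)
Lemma is_derive_comp (U : normedModType R) (g : U -> V) f (y u : U) (d : V) :
  differentiable f (g y) -> is_derive y u g d ->
  is_derive y u (fun z => f (g z)) ('D_d f (g y)).
Proof.
move=> df [dg gd].
pose g1 (h : R) := g (h *: u + y).
have g10 : g1 0 = g y by rewrite /g1 scale0r add0r.
have dg1 : differentiable g1 0.
  by apply/derivable1_diffP; exact: (iffLR (derivable1P _ _ _) dg).
have dfg1 : differentiable (f \o g1) 0.
  by apply: differentiable_comp => //; rewrite g10.
have dfg : derivable (fun z => f (g z)) y u.
  by apply: (iffRL (derivable1P _ _ _)); exact/derivable1_diffP.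
split=> //.
have D1 (Z : normedModType R) (k : U -> Z) :
    'D_u k y = 'D_1 (fun h : R => k (h *: u + y)) 0.
  rewrite /derive; set a := (X in X @ _); set b := (X in _ = lim (X @ _)).
  suff -> : a = b by [].
  by rewrite funeqE /a /b => h /=; rewrite addr0 scale0r add0r [_%:A]mulr1.
rewrite D1.
change ('D_1 (f \o g1) 0 = 'D_d f (g y)).
rewrite deriveE// diff_comp//= ?g10//.
rewrite -(deriveE _ dg1) -D1 gd deriveE//.
Qed.

Lemma is_derive_line f c v (s : R) : differentiable f (s *: v + c) ->
  is_derive s 1 (fun r : R => f (r *: v + c)) ('D_v f (s *: v + c)).
Proof.
move=> df; apply: (@is_derive_comp R (fun r : R => r *: v + c)) => //.
have -> : (fun r : R => r *: v + c) = *:%R^~ v + cst c by [].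
rewrite -[X in is_derive _ _ _ X]addr0.
apply: is_deriveD; apply: DeriveDef; first exact/diff_derivable.
by rewrite deriveE// diff_val scale1r.
Qed.

End DirectionalDerivatives.

Section Schwarz.
Context (R : realType) (V : normedModType R).
Implicit Types (f : V -> R) (x v w : V).

(** Mean value theorem for [phi], the difference of [f] along two parallel segments, followed by the
    first-order expansion of ['D_v f] at [x]. *)
Lemma second_difference f x v w :
  (\forall y \near x, differentiable f y) ->
  differentiable ('D_v f) x ->
  forall e : R, 0 < e -> \forall h \near 0^'+,
    `|f (x + h *: v + h *: w) - f (x + h *: v) - f (x + h *: w) + f x
      - h ^+ 2 * 'D_w ('D_v f) x| <= e * h ^+ 2.
Proof.
move=> nf dg e e0; set g := 'D_v f in dg *.
pose N := `|v| + `|w|; have N0 : 0 <= N by rewrite addr_ge0.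
(* Two remainders arise, at most [e' * h * N] each, with sum below [e' * h * (2 * N + 1) = e * h].
   The summand 1 keeps the divisor positive when [v = w = 0]. *)
pose e' := e / (2 * N + 1).
have P0 : 0 < 2 * N + 1 by lra.
have e'0 : 0 < e' by rewrite divr_gt0.
have ng : \forall k \near 0, `|g (k + x) - g x - 'd g x k| <= e' * `|k|.
  have /diff_locally/eqaddoP/(_ _ e'0) := dg.
  by apply: filterS => k /=; rewrite opprD addrA.
have nf0 : \forall k \near 0, differentiable f (k + x).
  by move: nf; rewrite (near_shift 0)/=; apply: filterS => k /=; rewrite subr0.
have [d /= d0 Hd] : exists2 d : R, 0 < d & forall k, `|k| < d ->
    differentiable f (k + x) /\ `|g (k + x) - g x - 'd g x k| <= e' * `|k|.
  have : \forall k \near (0 : V), differentiable f (k + x) /\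
      `|g (k + x) - g x - 'd g x k| <= e' * `|k|.
    by near do split.
  move=> /nbhs_ballP[d /= d0 Hd].
  by exists d => // k kd; apply: Hd; rewrite -ball_normE/= sub0r normrN.
near=> h.
have h0 : 0 < h by [].
have hN : h * N < d.
  apply: (@le_lt_trans _ _ (h * (2 * N + 1))); first by rewrite ler_wpM2l; lra.
  rewrite -ltr_pdivlMr//; near: h.
  by apply: nbhs_right_lt; rewrite divr_gt0.
pose phi (s : R) := f (s *: v + h *: w + x) - f (s *: v + x).
have sv s : 0 <= s <= h -> `|s *: v| <= h * `|v|.
  by move=> /andP[s0 sh]; rewrite normrZ ger0_norm// ler_wpM2r.
have svw s : 0 <= s <= h -> `|s *: v + h *: w| <= h * N.
  move=> hs; rewrite (le_trans (ler_normD _ _))// /N mulrDr lerD ?sv//.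
  by rewrite normrZ gtr0_norm.
have hv : h * `|v| <= h * N by apply: ler_wpM2l; rewrite ?lerDl// ltW.
have dphi s : 0 <= s <= h ->
    is_derive s 1 phi (g (s *: v + h *: w + x) - g (s *: v + x)).
  move=> hs; apply: is_deriveB.
    rewrite -!addrA; have : is_derive s 1 (fun r : R => f (r *: v + (h *: w + x)))
         ('D_v f (s *: v + (h *: w + x))).
      apply: is_derive_line; rewrite addrA.
      by apply: (Hd _ _).1; rewrite (le_lt_trans (svw _ hs)).
    by under eq_fun do rewrite addrA.
  apply: is_derive_line.
  by apply: (Hd _ _).1; rewrite (le_lt_trans (sv _ hs))// (le_lt_trans hv).
have [c /[!in_itv]/= /andP[c0 ch] phih] : exists2 c, c \in `]0, h[ &
    phi h - phi 0 =
    (g (c *: v + h *: w + x) - g (c *: v + x)) * (h - 0).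
  apply: (@MVT R phi (fun s => g (s *: v + h *: w + x) - g (s *: v + x))) => //.
    by move=> s /[!in_itv]/= /andP[? ?]; apply: dphi; rewrite !ltW.
  apply: derivable_within_continuous => s /[!in_itv]/= hs.
  by have [] := dphi _ hs.
have hc : 0 <= c <= h by rewrite !ltW.
have -> : f (x + h *: v + h *: w) - f (x + h *: v) - f (x + h *: w) + f x =
    phi h - phi 0.
  rewrite /phi scale0r !add0r addrC ![_ + x]addrC !addrA; ring.
rewrite phih subr0 deriveE//.
have lin : 'd g x (c *: v + h *: w) - 'd g x (c *: v) = h *: 'd g x w.
  by rewrite linearD addrC addKr linearZ.
have -> : (g (c *: v + h *: w + x) - g (c *: v + x)) * h - h ^+ 2 * 'd g x w =
  h * ((g (c *: v + h *: w + x) - g x - 'd g x (c *: v + h *: w))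
     - (g (c *: v + x) - g x - 'd g x (c *: v))).
  have -> : h ^+ 2 * 'd g x w = h * (h *: 'd g x w) by rewrite expr2 mulrA.
  rewrite -lin; ring.
rewrite normrM gtr0_norm// expr2 [e * _]mulrCA; apply: ler_wpM2l; first exact: ltW.
apply: le_trans (ler_normB _ _) _.
have E1 := (Hd _ (le_lt_trans (svw _ hc) hN)).2.
have E2 := (Hd _ (le_lt_trans (sv _ hc) (le_lt_trans hv hN))).2.
apply: le_trans (lerD E1 E2) _; rewrite -mulrDr.
apply: (@le_trans _ _ (e' * (h * (2 * N + 1)))).
  apply: ler_wpM2l; first exact: ltW.
  apply: le_trans (lerD (svw _ hc) (sv _ hc)) _.
  rewrite -mulrDr; apply: ler_wpM2l; first exact: ltW.
  by rewrite /N; have := normr_ge0 w; lra.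
by rewrite mulrCA /e' divfK ?lt0r_neq0// mulrC.
Unshelve. all: by end_near. Qed.

(** The second difference is symmetric in [v] and [w], so for small [h] both mixed derivatives are
    within [e / 2] of the same quotient by [h ^+ 2]. *)
Lemma schwarz f x v w :
  (\forall y \near x, differentiable f y) ->
  differentiable ('D_v f) x -> differentiable ('D_w f) x ->
  'D_v ('D_w f) x = 'D_w ('D_v f) x.
Proof.
move=> nf dv dw; apply/eqP; rewrite -subr_eq0 -normr_le0.
apply/ler_addgt0Pr => e e0; rewrite add0r.
have e20 : 0 < e / 2 by rewrite divr_gt0.
have A := second_difference w nf dv e20.
have B := second_difference v nf dw e20.
have [h [h0 [/= {}A {}B]]] := filter_ex
  (filterI (nbhs_right_gt (0 : R)) (filterI A B)).
have h20 : 0 < h ^+ 2 by rewrite exprn_gt0.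
have key (a b c d p q : R) : `|a - b - c + d - h ^+ 2 * q| <= e / 2 * h ^+ 2 ->
    `|a - c - b + d - h ^+ 2 * p| <= e / 2 * h ^+ 2 -> `|p - q| <= e.
  move=> {}A {}B; rewrite -(ler_pM2r h20) [X in _ <= X * _](splitr e) mulrDl.
  apply: le_trans (lerD A B); apply: le_trans (ler_normB _ _).
  rewrite -[X in _ * X](gtr0_norm h20) -normrM le_eqVlt; apply/orP; left; apply/eqP.
  by congr (`|_|); ring.
by rewrite (addrAC x (h *: w)) in B; exact: key A B.
Qed.

End Schwarz.

Section Lines.
Context (R : realType) (V W : normedModType R).
Implicit Types (x v : V).

Lemma derive_lineE (f : V -> W) x v : 'D_v f x = 'D_1 (fun h : R => f (h *: v + x)) 0.
Proof.
rewrite /derive; set a := (X in X @ _); set b := (X in _ = lim (X @ _)).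
suff -> : a = b by [].
by rewrite funeqE /a /b => h /=; rewrite addr0 scale0r add0r [_%:A]mulr1.
Qed.

(** Agreement along one line is enough; this serves identities known on a time slice only, which
    contains no neighbourhood of its points. *)
Lemma derive_eq_line (f g : V -> W) x v :
  (\forall h \near (0 : R), f (h *: v + x) = g (h *: v + x)) ->
  'D_v f x = 'D_v g x.
Proof. by move=> fg; rewrite !derive_lineE; exact: near_eq_derive. Qed.

End Lines.

(** * First and second derivative tests at a maximum along a line *)

Section DerivativeTests.
Context (R : realType) (V : normedModType R).
Implicit Types (f : V -> R) (x v : V).

Lemma near_line (P : set V) x v :
  (\forall y \near x, P y) -> \forall h \near (0 : R), P (h *: v + x).
Proof.
have c : h *: v + x @[h --> (0 : R)] --> x.
  rewrite -[X in _ --> X]add0r -[X in _ --> X + _](scale0r v).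
  by apply: cvgD; [apply: cvgZr_tmp; exact: cvg_id|exact: cvg_cst].
by move=> /c.
Qed.

Lemma derive_cvg_right f x v : derivable f x v ->
  h^-1 * (f (h *: v + x) - f x) @[h --> 0^'+] --> 'D_v f x.
Proof. by move=> df; apply: cvg_dnbhs_at_right. Qed.

(** One-sided comparison is all that a maximum over earlier times provides, in the direction
    [- time]. *)
Lemma derive_right_le0 f x v : derivable f x v ->
  (\forall h \near 0^'+, f (h *: v + x) <= f x) -> 'D_v f x <= 0.
Proof.
move=> /derive_cvg_right df nf; apply: (cvgr_to_le df); near=> h.
have h0 : 0 < h by [].
rewrite pmulr_rle0 ?invr_gt0// subr_le0; near: h; exact: nf.
Unshelve. all: by end_near. Qed.

Lemma derive_local_max f x v : differentiable f x ->
  (\forall h \near (0 : R), f (h *: v + x) <= f x) -> 'D_v f x = 0.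
Proof.
move=> df nf; apply/eqP; rewrite eq_le; apply/andP; split.
  apply: derive_right_le0; first exact: diff_derivable.
  exact: cvg_within.
have nf' : \forall h \near (0 : R), f (h *: - v + x) <= f x.
  have nf1 := nf; rewrite -oppr0 nearN in nf1; apply: filterS nf1 => h.
  by rewrite scalerN scaleNr.
have : 'D_(- v) f x <= 0.
  apply: derive_right_le0; first exact: diff_derivable.
  exact: cvg_within.
by rewrite !deriveE// linearN oppr_le0.
Qed.

(** If the second derivative were positive, the first, which vanishes at [x], would be positive just
    beyond it along [v], and by the mean value theorem [f] would exceed [f x] there. *)
Lemma derive2_local_max f x v :
  (\forall y \near x, differentiable f y) -> differentiable ('D_v f) x ->
  (\forall h \near (0 : R), f (h *: v + x) <= f x) -> 'D_v ('D_v f) x <= 0.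
Proof.
move=> ndf ddf nf; rewrite leNgt; apply/negP => D0.
have D1 : 'D_v f x = 0.
  by apply: derive_local_max => //; exact: nbhs_singleton ndf.
have dv : derivable ('D_v f) x v by exact: diff_derivable.
have := derive_cvg_right dv; rewrite D1 => /cvgr_gt/(_ _ D0) [d /= d0 Hd].
have : \forall h \near (0:R), differentiable f (h *: v + x) /\ f (h *: v + x) <= f x.
  have ndf' := near_line v ndf; near=> h; split; near: h; [exact: ndf'|exact: nf].
move=> /nbhs_ballP[d' /= d'0 Hd'].
have m0 : 0 < Num.min d d' by rewrite lt_min d0.
pose h := Num.min d d' / 2.
have h0 : 0 < h by rewrite divr_gt0.
have hm : h < Num.min d d' by rewrite /h; lra.
have [hd hd'] : h < d /\ h < d' by move: hm; rewrite lt_min => /andP.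
have good s : 0 <= s <= h -> differentiable f (s *: v + x) /\ f (s *: v + x) <= f x.
  move=> /andP[s0 sh]; apply: Hd'.
  by rewrite -ball_normE/= sub0r normrN ger0_norm// (le_lt_trans sh).
have dline s : 0 <= s <= h ->
    is_derive s 1 (fun r : R => f (r *: v + x)) ('D_v f (s *: v + x)).
  by move=> /good[? _]; exact: is_derive_line.
have [s /[!in_itv]/= /andP[s0 sh]| |c /[!in_itv]/= /andP[c0 ch]] :=
  @MVT R (fun r : R => f (r *: v + x)) (fun s => 'D_v f (s *: v + x)) 0 h h0.
- by apply: dline; rewrite !ltW.
- apply: derivable_within_continuous => s /[!in_itv]/= hs.
  by have [] := dline _ hs.
rewrite subr0 scale0r add0r => E.
have pos : 0 < 'D_v f (c *: v + x).
  have : 0 < c^-1 * ('D_v f (c *: v + x) - 0).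
    by apply: Hd; rewrite //= sub0r normrN gtr0_norm// (lt_trans ch).
  by rewrite subr0 pmulr_rgt0 ?invr_gt0.
have : f (h *: v + x) <= f x by apply: (good _ _).2; rewrite lexx ltW.
by rewrite leNgt -subr_gt0 E mulr_gt0.
Unshelve. all: by end_near. Qed.

End DerivativeTests.

Lemma derive_slice (R : realType) (V W : normedModType R) (f : V * R -> W)
    (g : V -> W) (a x : V) (t : R) :
  (\forall h \near (0 : R), f (h *: a + x, t) = g (h *: a + x)) ->
  'D_((a, 0) : V * R) f (x, t) = 'D_a g x.
Proof.
move=> fg; rewrite derive_lineE [RHS]derive_lineE; apply: near_eq_derive.
apply: filterS fg => h <-; congr (f _); congr pair.
by rewrite -[LHS]/(h *: 0 + t) scaler0 add0r.
Qed.

(** * Smooth functions *)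

Definition smooth (R : realType) (V W : normedModType R) (O : set V) (f : V -> W) :=
  forall k, Ck k O f.

Section Smooth.
Context (R : realType) (V W : normedModType R).
Implicit Types (O : set V) (f g : V -> W) (x v : V).

Lemma smooth_derive O f v : smooth O f -> smooth O ('D_v f).
Proof. by move=> sf k; have [_] := sf k.+1; apply. Qed.

Lemma smooth_differentiable O f x : smooth O f -> O x -> differentiable f x.
Proof. by move=> sf; have [+ _] := sf 1%N; apply. Qed.

Lemma smooth_near_differentiable O f x : open O -> smooth O f -> O x ->
  \forall y \near x, differentiable f y.
Proof.
move=> oO sf Ox; have : \forall y \near x, O y by exact: open_nbhs_nbhs.
by apply: filterS => y; exact: smooth_differentiable.
Qed.

Lemma open_eq_derive O f g v x : open O -> (forall y, O y -> f y = g y) ->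
  O x -> 'D_v f x = 'D_v g x.
Proof.
move=> oO fg Ox; apply: near_eq_derive.
have : \forall y \near x, O y by exact: open_nbhs_nbhs.
by apply: filterS => y; exact: fg.
Qed.

Lemma open_eq_differentiable O f g x : open O -> (forall y, O y -> f y = g y) ->
  O x -> differentiable f x -> differentiable g x.
Proof.
move=> oO fg Ox df.
have nO : \forall h \near (0 : V), f (h + x) = g (h + x).
  have : \forall y \near x, O y by exact: open_nbhs_nbhs.
  rewrite (near_shift 0)/=; apply: filterS => h /=; rewrite subr0; exact: fg.
have [dc /eqaddoP df'] := iffLR (diff_locallyP _ _) df.
have dg : g \o shift x = cst (g x) + 'd f x +o_ 0 id.
  apply/eqaddoP => e e0; have := df' _ e0.
  move=> dfe; near=> h.
  have -> : (g \o shift x - (cst (g x) + 'd f x)) h =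
            (f \o shift x - (cst (f x) + 'd f x)) h.
    by rewrite !fctE/= -(fg _ Ox); congr (_ - _); apply/esym; near: h.
  by near: h.
by apply/diff_locallyP; rewrite (diff_unique dc dg).
Unshelve. all: by end_near. Qed.

Lemma near_eq_differentiable f g x : (\forall y \near x, f y = g y) ->
  differentiable f x -> differentiable g x.
Proof.
move=> nfg.
pose A := [set y | f y = g y].
have Ax : A^° x by exact: nbhs_singleton (nbhs_interior nfg).
apply: (open_eq_differentiable (@open_interior _ A)) => // y.
exact: interior_subset.
Qed.

Lemma Ck_eq k O f g : open O -> (forall y, O y -> f y = g y) ->
  Ck k O f -> Ck k O g.
Proof.
elim: k f g => [|k IH] f g oO fg /=.
  move=> cf x Ox; suff : g @ x --> g x by [].
  rewrite -(fg _ Ox); apply: cvg_trans (cf x Ox); apply: near_eq_cvg.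
  have : \forall y \near x, O y by exact: open_nbhs_nbhs.
  by apply: filterS => y Oy; rewrite fg.
move=> [df Df]; split=> [x Ox|v]; first 
  exact: open_eq_differentiable oO fg Ox (df x Ox).
by apply: (IH ('D_v f)) => // x Ox; exact: open_eq_derive oO fg Ox.
Qed.

Lemma smooth_subset O O' f : O' `<=` O -> smooth O f -> smooth O' f.
Proof.
move=> OO' sf k; elim: k f sf => [|k IH] f sf /=.
  by move=> x /OO'; exact: (sf 0%N).
split=> [x /OO'|v]; first exact: smooth_differentiable.
by apply: IH; exact: smooth_derive.
Qed.

End Smooth.

Section SmoothLinear.
Context (R : realType) (V' V W : normedModType R) (l : {linear V' -> V}).
Hypothesis lc : continuous l.

Lemma differentiable_comp_lin (g : V -> W) x :
  differentiable g (l x) -> differentiable (g \o l) x.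
Proof.
by move=> dg; apply: differentiable_comp => //; exact: linear_differentiable.
Qed.

Lemma derive_comp_lin (g : V -> W) x v :
  differentiable g (l x) -> 'D_v (g \o l) x = 'D_(l v) g (l x).
Proof.
move=> dg; rewrite deriveE; last exact: differentiable_comp_lin.
rewrite diff_comp//=; last exact: linear_differentiable.
by rewrite diff_lin// deriveE.
Qed.

(** Induction on the order: on the preimage of [O], the derivative of the composite along [v] is
    ['D_(l v) g] composed with [l], again of the same form. *)
Lemma smooth_comp_lin O (g : V -> W) :
  open O -> smooth O g -> smooth (l @^-1` O) (g \o l).
Proof.
move=> oO sg k; elim: k g sg => [|k IH] g sg /=.
  move=> x Ox; apply: continuous_comp; first exact: lc.
  exact: (sg 0%N).
split=> [x Ox|v].
  exact/differentiable_comp_lin/(smooth_differentiable sg).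
apply: (@Ck_eq _ _ _ _ _ ('D_(l v) g \o l)).
- by apply: open_comp => // x _; exact: lc.
- move=> x Ox /=; rewrite derive_comp_lin//; exact: smooth_differentiable sg _.
- by apply: IH; exact: smooth_derive.
Qed.

End SmoothLinear.

Lemma smooth_schwarz (R : realType) (V : normedModType R) (O : set V)
    (f : V -> R) x v w :
  open O -> smooth O f -> O x -> 'D_v ('D_w f) x = 'D_w ('D_v f) x.
Proof.
move=> oO sf Ox; apply: schwarz; first exact: smooth_near_differentiable sf _.
  exact: smooth_differentiable (smooth_derive v sf) _.
exact: smooth_differentiable (smooth_derive w sf) _.
Qed.

(** * Second-order jets *)

Section TwiceDifferentiable.
Context (R : realType) (V : normedModType R).
Implicit Types (f g : V -> R) (x v : V).

Definition twice_differentiable f x :=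
  (\forall y \near x, differentiable f y) /\
  forall v, differentiable ('D_v f) x.

Lemma twice_differentiable_at f x : twice_differentiable f x -> differentiable f x.
Proof. by move=> [+ _]; exact: nbhs_singleton. Qed.

Lemma smooth_twice_differentiable O f x :
  open O -> smooth O f -> O x -> twice_differentiable f x.
Proof.
move=> oO sf Ox; split; first exact: smooth_near_differentiable sf _.
by move=> v; exact: smooth_differentiable (smooth_derive v sf) _.
Qed.

Lemma twice_differentiable_near f (df : V -> V -> R) x :
  (\forall y \near x, differentiable f y /\ forall v, 'D_v f y = df v y) ->
  (forall v, differentiable (df v) x) ->
  twice_differentiable f x /\ (forall v, 'D_v ('D_v f) x = 'D_v (df v) x).
Proof.
move=> ndf ddf.
have nv v : \forall y \near x, df v y = 'D_v f y.
  by apply: filterS ndf => y [].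
split; last first.
  by move=> v; apply: near_eq_derive; apply: filterS (nv v) => y ->.
split; first by apply: filterS ndf => y [].
by move=> v; exact: near_eq_differentiable (nv v) (ddf v).
Qed.

Lemma is_derive_mul f g x v : differentiable f x -> differentiable g x ->
  is_derive x v (fun y => f y * g y) (f x * 'D_v g x + g x * 'D_v f x).
Proof.
move=> df dg; apply: (@is_deriveM _ _ f g); exact: is_derive_diff.
Qed.

(** Only pure second derivatives are recorded, since the elliptic operator is later a sum of squares
    of directional derivatives. The closure rules below compute the derivatives of the test function
    at its maximum. *)
Definition jet2 f x (d1 d2 : V -> R) :=
  [/\ twice_differentiable f x, forall v, 'D_v f x = d1 v &
      forall v, 'D_v ('D_v f) x = d2 v].

Lemma jet2_eq f g x d1 d2 : (forall y, f y = g y) -> jet2 f x d1 d2 -> jet2 g x d1 d2.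
Proof. by move=> /funext ->. Qed.

Lemma jet2M f g x f1 f2 g1 g2 : jet2 f x f1 f2 -> jet2 g x g1 g2 ->
  jet2 (fun y => f y * g y) x (fun v => f x * g1 v + g x * f1 v)
    (fun v => f2 v * g x + 2 * (f1 v * g1 v) + f x * g2 v).
Proof.
move=> [tf Df DDf] [tg Dg DDg].
have df := twice_differentiable_at tf; have dg := twice_differentiable_at tg.
have [||td E] := @twice_differentiable_near (fun y => f y * g y)
   (fun v y => f y * 'D_v g y + g y * 'D_v f y) x.
- have [nf _] := tf; have [ng _] := tg.
  near=> y.
  have dfy : differentiable f y by near: y.
  have dgy : differentiable g y by near: y.
  split; first exact: differentiableM.
  by move=> v; have [] := is_derive_mul v dfy dgy.
- by move=> v; apply: differentiableD; apply: differentiableM => //;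
    apply: tf.2 || apply: tg.2.
split=> [|v|v]; first exact: td.
  by have [_ ->] := is_derive_mul v df dg; rewrite Df Dg.
have D1 := is_derive_mul v df (tg.2 v); have D2 := is_derive_mul v dg (tf.2 v).
have [_ D] := is_deriveD D1 D2.
by rewrite E [LHS]D Df Dg DDf DDg; ring.
Unshelve. all: by end_near. Qed.

Lemma jet2D f g x f1 f2 g1 g2 : jet2 f x f1 f2 -> jet2 g x g1 g2 ->
  jet2 (fun y => f y + g y) x (fun v => f1 v + g1 v) (fun v => f2 v + g2 v).
Proof.
move=> [tf Df DDf] [tg Dg DDg].
have df := twice_differentiable_at tf; have dg := twice_differentiable_at tg.
have [||td E] := @twice_differentiable_near (fun y => f y + g y)
   (fun v y => 'D_v f y + 'D_v g y) x.
- have [nf _] := tf; have [ng _] := tg.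
  near=> y.
  have dfy : differentiable f y by near: y.
  have dgy : differentiable g y by near: y.
  split; first exact: differentiableD.
  by move=> v; apply: deriveD; exact: diff_derivable.
- by move=> v; apply: differentiableD; [apply: tf.2|apply: tg.2].
split=> [|v|v]; first exact: td.
  by rewrite -Df -Dg; apply: deriveD; exact: diff_derivable.
rewrite E -DDf -DDg; apply: deriveD; apply: diff_derivable; [apply: tf.2|apply: tg.2].
Unshelve. all: by end_near. Qed.

Lemma jet2_cst (a : R) x : jet2 (fun=> a) x (fun=> 0) (fun=> 0).
Proof.
have E v : 'D_v (fun=> a) = (fun=> 0) :> (V -> R).
  by apply/funext => y; rewrite (derive_cst a).
split=> [|v|v]; last by rewrite E (derive_cst 0).
  split; first by near=> y; exact: differentiable_cst.
  by move=> v; rewrite E; exact: differentiable_cst.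
exact: (congr1 (fun g => g x) (E v)).
Unshelve. all: by end_near. Qed.

Lemma jet2Z a f x f1 f2 : jet2 f x f1 f2 ->
  jet2 (fun y => a * f y) x (fun v => a * f1 v) (fun v => a * f2 v).
Proof.
move=> jf; have [td D DD] := jet2M (jet2_cst a x) jf.
by split=> [|v|v]; [exact: td|rewrite D mulr0 addr0|rewrite DD !mul0r mulr0 !add0r].
Qed.

Lemma jet2_sum (I : finType) (f f1 f2 : I -> V -> R) x :
  (forall i, jet2 (f i) x (f1 i) (f2 i)) ->
  jet2 (fun y => \sum_i f i y) x (fun v => \sum_i f1 i v) (fun v => \sum_i f2 i v).
Proof.
move=> jf; elim: (index_enum I) => [|i s js].
  have [td D DD] := jet2_cst 0 x.
  have E : (fun y => \sum_(i <- [::]) f i y) = (fun=> 0).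
    by apply/funext => y; rewrite big_nil.
  by rewrite E; split=> [|v|v]; [exact: td|rewrite big_nil D|rewrite big_nil DD].
have E : (fun y => \sum_(j <- i :: s) f j y) = (fun y => f i y + \sum_(j <- s) f j y).
  by apply/funext => y; rewrite big_cons.
have [td D DD] := jet2D (jf i) js.
by rewrite E; split=> [|v|v]; [exact: td|rewrite big_cons D|rewrite big_cons DD].
Qed.

Lemma jet2_linear f x : linear f -> continuous f -> jet2 f x f (fun=> 0).
Proof.
move=> fl fc; pose l : {linear V -> R} := HB.pack f (GRing.isLinear.Build _ _ _ _ f fl).
have E v : 'D_v f = (fun=> f v).
  apply/funext => y; rewrite (@deriveE _ _ _ l); last exact: linear_differentiable.
  by rewrite diff_lin.
split=> [|v|v]; last by rewrite E (derive_cst (f v)).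
  split; first by near=> y; exact: (@linear_differentiable _ _ _ l).
  by move=> v; rewrite E; exact: differentiable_cst.
exact: (congr1 (fun g => g x) (E v)).
Unshelve. all: by end_near. Qed.

Lemma is_derive_expR_comp f x v : differentiable f x ->
  is_derive x v (fun y => expR (f y)) (expR (f x) * 'D_v f x).
Proof.
move=> df.
have de : differentiable (@expR R) (f x).
  by apply/derivable1_diffP; apply: ex_derive.
have := is_derive_comp de (is_derive_diff v df).
rewrite -[X in derive _ _ X]mulr1 derive_dirZ//.
by rewrite (@derive_val _ _ _ _ _ _ _ (is_derive_expR _)) [_ *: _]mulrC.
Qed.

Lemma jet2_expR f x f1 f2 : jet2 f x f1 f2 ->
  jet2 (fun y => expR (f y)) x (fun v => expR (f x) * f1 v)
    (fun v => expR (f x) * (f2 v + f1 v ^+ 2)).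
Proof.
move=> [tf Df DDf].
have dexp y : differentiable f y -> differentiable (fun y => expR (f y)) y.
  move=> df; apply: differentiable_comp => //.
  by apply/derivable1_diffP; apply: ex_derive.
have df := twice_differentiable_at tf.
have [||td E] := @twice_differentiable_near (fun y => expR (f y))
   (fun v y => expR (f y) * 'D_v f y) x.
- apply: filterS tf.1 => y dfy; split; first exact: dexp.
  by move=> v; have [] := is_derive_expR_comp v dfy.
- by move=> v; apply: differentiableM; [exact: dexp|apply: tf.2].
split=> [|v|v]; first exact: td.
  by have [_ ->] := is_derive_expR_comp v df; rewrite Df.
rewrite E; have [_ ->] := is_derive_mul v (dexp _ df) (tf.2 v).
have [_ ->] := is_derive_expR_comp v df.
by rewrite Df DDf; ring.
Qed.

Lemma jet2_smooth O f x : open O -> smooth O f -> O x ->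
  jet2 f x (fun v => 'D_v f x) (fun v => 'D_v ('D_v f) x).
Proof. by move=> oO sf Ox; split=> //; exact: smooth_twice_differentiable sf Ox. Qed.

End TwiceDifferentiable.

(** * Space-time derivatives and the graphical flow equation *)

Section DotProduct.
Context (R : realType) (m : nat).
Implicit Types a b c : 'rV[R]_m.

Lemma dotC a b : dot a b = dot b a.
Proof. by apply: eq_bigr => i _; rewrite mulrC. Qed.

Lemma dotDl a b c : dot (a + b) c = dot a c + dot b c.
Proof. by rewrite -big_split; apply: eq_bigr => i _; rewrite mxE mulrDl. Qed.

Lemma dotZl k a c : dot (k *: a) c = k * dot a c.
Proof. by rewrite mulr_sumr; apply: eq_bigr => i _; rewrite mxE mulrA. Qed.

Lemma dotNl a c : dot (- a) c = - dot a c.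
Proof. by rewrite -scaleN1r dotZl mulN1r. Qed.

Lemma dotBl a b c : dot (a - b) c = dot a c - dot b c.
Proof. by rewrite dotDl dotNl. Qed.

Lemma dotZr k a c : dot c (k *: a) = k * dot c a.
Proof. by rewrite dotC dotZl (dotC c). Qed.

Lemma dotBr a b c : dot c (a - b) = dot c a - dot c b.
Proof. by rewrite dotC dotBl !(dotC c). Qed.

Lemma dot_ge0 a : 0 <= dot a a.
Proof. by apply: sumr_ge0 => i _; rewrite -expr2 sqr_ge0. Qed.

Lemma dot_eq0 a : (dot a a == 0) = (a == 0).
Proof.
apply/eqP/eqP => [|->]; last by rewrite /dot big1// => i _; rewrite mxE mul0r.
move=> /psumr_eq0P a0; apply/rowP => i; rewrite mxE; apply/eqP.
by rewrite -sqrf_eq0 expr2 a0// => j _; rewrite -expr2 sqr_ge0.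
Qed.

Lemma dot_delta a i : dot a (delta_mx 0 i) = a 0 i.
Proof.
rewrite /dot (bigD1 i)//= mxE !eqxx mulr1 big1 ?addr0// => j ji.
by rewrite mxE eqxx (negbTE ji) mulr0.
Qed.

Lemma dot_mx a b : dot a b = (a *m b^T) 0 0.
Proof. by rewrite mxE; apply: eq_bigr => i _; rewrite mxE. Qed.

Lemma cauchy_schwarz a b : dot a b ^+ 2 <= dot a a * dot b b.
Proof.
have [/eqP|b0] := eqVneq (dot b b) 0.
  rewrite dot_eq0 => /eqP ->.
  by rewrite dotC -(scale0r a) !dotZl !mul0r mulr0 expr0n.
have bp : 0 < dot b b by rewrite lt_def b0 dot_ge0.
have := dot_ge0 (dot b b *: a - dot a b *: b).
rewrite dotBl !dotBr !dotZl !dotZr (dotC b a).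
set p := dot a b; set q := dot b b in b0 bp *; set r := dot a a => H.
have : 0 <= q * (r * q - p ^+ 2) by move: H; rewrite !expr2; lra.
by rewrite pmulr_rge0// subr_ge0.
Qed.

End DotProduct.

(* [derive] with a sealed body: unification never unfolds it to a limit. *)
HB.lock Definition dd (R : realType) (V W : normedModType R) (v : V)
  (f : V -> W) : V -> W := 'D_v f.

Section SealedDerivative.
Context (R : realType) (V : normedModType R) (O : set V) (F : V -> R).
Hypotheses (oO : open O) (sF : smooth O F).
Implicit Types (z u v : V).

Lemma ddE (W : normedModType R) v (f : V -> W) : 'D_v f = dd v f.
Proof. by rewrite unlock. Qed.

Lemma is_derive_ddE f z v d : is_derive z v f d -> dd v f z = d :> R.
Proof. by rewrite -ddE => -[]. Qed.

Lemma smooth_dd v : smooth O (dd v F).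
Proof. by rewrite -ddE; exact: smooth_derive. Qed.

Lemma is_derive_dd z v : O z -> is_derive z v F (dd v F z).
Proof. by rewrite -ddE => Oz; exact: is_derive_diff (smooth_differentiable sF Oz). Qed.

Lemma ddC z u v : O z -> dd u (dd v F) z = dd v (dd u F) z.
Proof. by rewrite -!ddE => Oz; exact: smooth_schwarz oO sF Oz. Qed.

Lemma ddD z u v : O z -> dd (u + v) F z = dd u F z + dd v F z.
Proof. by rewrite -!ddE => Oz; apply: derive_dirD; exact: smooth_differentiable sF Oz. Qed.

Lemma ddZ z a v : O z -> dd (a *: v) F z = a * dd v F z.
Proof. by rewrite -!ddE => Oz; apply: derive_dirZ; exact: smooth_differentiable sF Oz. Qed.

End SealedDerivative.

Lemma open_eq_dd (R : realType) (V : normedModType R) (O : set V) (F G : V -> R) v z :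
  open O -> (forall y, O y -> F y = G y) -> O z -> dd v F z = dd v G z.
Proof. by rewrite -!ddE; exact: open_eq_derive. Qed.

Section SpaceTime.
Context (R : realType) (m : nat).
Local Notation V := ('rV[R]_m * R)%type.
Implicit Types (a b w : 'rV[R]_m) (z : V) (G F : V -> R).

Definition space a : V := (a, 0).
Definition axis (i : 'I_m) : V := space (delta_mx 0 i).
Definition time : V := (0, 1).

Lemma spaceD a b : space (a + b) = space a + space b.
Proof. by rewrite /space; congr pair; rewrite addr0. Qed.

Lemma spaceZ k a : space (k *: a) = k *: space a.
Proof. by rewrite /space; congr pair; rewrite scaler0. Qed.

Lemma space_sum a : space a = \sum_i a 0 i *: axis i.
Proof.
rewrite [in LHS](row_sum_delta a).
elim/big_ind2: _ => [|x x' y y' <- <-|i _]; last exact: spaceZ.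
  by rewrite /space.
by rewrite spaceD.
Qed.

Definition gradient G z : 'rV[R]_m := \row_i dd (axis i) G z.

Definition laplacian F z := \sum_i dd (axis i) (dd (axis i) F) z.

(* [w - gradient G z] is the upward normal of length [sqrt (1 + |DG|^2)], so
   that the right-hand side is the trace of the Hessian over its orthogonal
   complement. *)
Definition graph_mcf w G z := let N := w - gradient G z in
  dd time G z = laplacian G z - dd (space N) (dd (space N) G) z / dot N N.

Lemma scalable_sum (f : V -> R) a :
  (forall u v, f (u + v) = f u + f v) -> (forall k u, f (k *: u) = k * f u) ->
  f (space a) = \sum_i a 0 i * f (axis i).
Proof.
move=> fD fZ; have f0 : f 0 = 0 by rewrite -(scale0r 0) fZ mul0r.
rewrite space_sum; elim/big_ind2: _ => // x x' y y' <- <-.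
exact: fD.
Qed.

Lemma dd_space (O : set V) G z a : smooth O G -> O z ->
  dd (space a) G z = dot a (gradient G z).
Proof.
move=> sG Oz; rewrite (scalable_sum (f := fun u => dd u G z)).
- by apply: eq_bigr => i _; rewrite mxE.
- by move=> u v; exact: ddD sG _ _ _ Oz.
- by move=> k v; exact: ddZ sG _ _ _ Oz.
Qed.

End SpaceTime.
Arguments time {R m}.
Arguments axis {R m}.

(** * Evolution of the slope *)

Lemma is_derive_bigsum (R : realType) (V : normedModType R) (I : finType)
    (h : I -> V -> R) (dh : I -> R) (x v : V) :
  (forall i, is_derive x v (h i) (dh i)) ->
  is_derive x v (fun y => \sum_i h i y) (\sum_i dh i).
Proof.
move=> H.
have -> : (fun y => \sum_i h i y) = \sum_i h i by apply/funext => y; rewrite fct_sumE.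
elim/big_ind2: _ => [|f a g b fa gb|i _]; last exact: H.
  exact: is_derive_cst.
exact: is_deriveD.
Qed.

Section EvolutionOfSlope.
Context (R : realType) (m : nat).
Local Notation V := ('rV[R]_m * R)%type.
Variables (w : 'rV[R]_m) (O : set V) (G : V -> R).
Hypotheses (oO : open O) (sG : smooth O G).

Lemma dd2_space F z (a : 'rV[R]_m) : smooth O F -> O z ->
  dd (space a) (dd (space a) F) z =
  \sum_i \sum_j a 0 i * a 0 j * dd (axis i) (dd (axis j) F) z.
Proof.
move=> sF Oz; rewrite (dd_space _ (smooth_dd sF _) Oz).
apply: eq_bigr => i _; rewrite mxE.
rewrite (ddC oO sF _ _ Oz) (dd_space _ (smooth_dd sF _) Oz).
rewrite mulr_sumr; apply: eq_bigr => j _; rewrite mxE mulrA.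
by rewrite (ddC oO sF _ _ Oz).
Qed.

Section Projection.
Variables (N : 'rV[R]_m).
Hypothesis N0 : dot N N != 0.

(* The projections of the coordinate vectors onto the complement of N.  The
   projection matrix is its own square, so the frozen elliptic operator is the
   sum of the squares of these directional derivatives. *)
Definition tangent k : V := space (delta_mx 0 k - (N 0 k / dot N N) *: N).

Lemma tangentE k : tangent k = axis k + (- (N 0 k / dot N N)) *: space N.
Proof. by rewrite /tangent spaceD -scaleNr spaceZ. Qed.

(** With [b_k = e_k - (N_k / |N|^2) N] and [H] the Hessian, the mixed terms add up to
    [-2 H(N, N) / |N|^2] and the terms in [N] alone to [H(N, N) / |N|^2]. *)
Lemma trace_tangent F z : smooth O F -> O z ->
  \sum_k dd (tangent k) (dd (tangent k) F) z =
  laplacian F z - dd (space N) (dd (space N) F) z / dot N N.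
Proof.
move=> sF Oz.
pose H u v := dd u (dd v F) z.
have HC u v : H u v = H v u := ddC oO sF u v Oz.
have HD u u' v : H (u + u') v = H u v + H u' v :=
  ddD (smooth_dd sF v) u u' Oz.
have HZ a u v : H (a *: u) v = a * H u v :=
  ddZ (smooth_dd sF v) a u Oz.
rewrite -/(H (space N) (space N)).
have E k : dd (tangent k) (dd (tangent k) F) z = H (axis k) (axis k)
   + (- 2 / dot N N) * (N 0 k * H (axis k) (space N))
   + (H (space N) (space N) / dot N N ^+ 2) * (N 0 k * N 0 k).
  rewrite tangentE -/(H _ _) HD HZ ![H _ (_ + _)]HC !HD !HZ (HC (space N) (axis k)).
  by field; exact: N0.
rewrite (eq_bigr _ (fun k _ => E k)) !big_split/= -!mulr_sumr -/(dot N N).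
rewrite -(scalable_sum (f := fun u => H u (space N))) => //.
rewrite -[\sum_(i < m) H _ _]/(laplacian F z).
by field; exact: N0.
Qed.

(** Pythagoras: the summands are the squared coordinates of the projection of [a] onto the
    complement of [N]. For [a] a gradient they are squared tangential derivatives. *)
Lemma sum_sqr_tangent (a : 'rV[R]_m) : \sum_k (a 0 k - N 0 k / dot N N * dot N a) ^+ 2 =
  dot a a - dot N a ^+ 2 / dot N N.
Proof.
have S0 : dot N N != 0 by exact: N0.
pose r := dot N a.
have E k : (a 0 k - N 0 k / dot N N * r) ^+ 2 = a 0 k * a 0 k
   + (- 2 * r / dot N N) * (N 0 k * a 0 k) + (r / dot N N) ^+ 2 * (N 0 k * N 0 k).
  by field.
rewrite (eq_bigr _ (fun k _ => E k)) !big_split/= -!mulr_sumr.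
rewrite -/(dot a a) -/(dot N a) -/(dot N N) -/r.
by field.
Qed.

Lemma dot_tangent k : dot (tangent k).1 (tangent k).1 = 1 - N 0 k ^+ 2 / dot N N.
Proof.
rewrite /tangent /= dotBl !dotBr !dotZl !dotZr !dot_delta (dotC (delta_mx 0 k) N) dot_delta.
have -> : (delta_mx 0 k : 'rV[R]_m) 0 k = 1 by rewrite mxE !eqxx.
by field; exact: N0.
Qed.

Lemma dd_tangent F z k : smooth O F -> O z ->
  dd (tangent k) F z = gradient F z 0 k - N 0 k / dot N N * dot N (gradient F z).
Proof.
move=> sF Oz; rewrite tangentE (ddD sF _ _ Oz) (ddZ sF _ _ Oz) (dd_space _ sF Oz).
by rewrite mxE mulNr.
Qed.

End Projection.

Variables (x0 : 'rV[R]_m) (t0 : R).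
Hypothesis Oz0 : O (x0, t0).
Hypothesis pde : forall x, O (x, t0) -> graph_mcf w G (x, t0).

Let N z := w - gradient G z.
Let z0 : V := (x0, t0).
Let N0 := N z0.
Let S := dot N0 N0.
Hypothesis S0 : S != 0.
Let nu : V := space N0.

Let L (F : V -> R) : R := dd time F z0 - \sum_k dd (tangent N0 k) (dd (tangent N0 k) F) z0.

(** The flow equation is available at time [t0] only, since an extension of the height past the last
    time need not solve it; lines in spatial directions stay in that slice. *)
Let near_slice (P : V -> Prop) a : (forall x, O (x, t0) -> P (x, t0)) ->
  \forall h \near (0 : R), P (h *: space a + z0).
Proof.
move=> HP; have : \forall z \near z0, O z by exact: open_nbhs_nbhs.
move=> /near_line -/(_ (space a)); apply: filterS => h.
have -> : h *: space a + z0 = (h *: a + x0, t0).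
  by rewrite -spaceZ /space /z0; congr pair; rewrite add0r.
exact: HP.
Qed.

Lemma heat_height : L G = 0.
Proof. by rewrite /L (trace_tangent S0 sG Oz0) (pde Oz0) subrr. Qed.

Let sGnu : smooth O (dd nu G). Proof. exact: smooth_dd. Qed.

Let q := gradient (dd nu G) z0.
Let r := dot N0 q.

Let dN z i : O z -> is_derive z nu (fun y => N y 0 i) (- dd (axis i) (dd nu G) z).
Proof.
move=> Oz.
have -> : (fun y => N y 0 i) = cst (w 0 i) - dd (axis i) G.
  by apply/funext => y; rewrite !mxE.
rewrite (ddC oO sG _ _ Oz).
have := is_deriveB (is_derive_cst (w 0 i) z nu)
  (is_derive_dd (smooth_dd sG (axis i)) nu Oz).
by rewrite sub0r.
Qed.

Lemma heat_slope : L (dd nu G) = 2 / S * \sum_k dd (tangent N0 k) (dd nu G) z0 ^+ 2.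
Proof.
rewrite (eq_bigr _ (fun k _ => congr1 (fun a => a ^+ 2) (dd_tangent N0 k sGnu Oz0))).
rewrite sum_sqr_tangent// -/q -/r -/S.
rewrite /L (trace_tangent S0 sGnu Oz0) (ddC oO sG _ _ Oz0).
(* The direction [N z] moves with [z]; written as an explicit quadratic form, the normal second
   derivative can be differentiated factor by factor. *)
pose Q z := \sum_i \sum_j N z 0 i * N z 0 j * dd (axis i) (dd (axis j) G) z.
have QE z : O z -> dd (space (N z)) (dd (space (N z)) G) z = Q z.
  by move=> Oz; exact: dd2_space.
have -> : dd nu (dd time G) z0 =
    dd nu (fun z => laplacian G z - Q z / dot (N z) (N z)) z0.
  rewrite -[in LHS]ddE -[in RHS]ddE; apply: derive_eq_line.
  apply: (near_slice (P := fun z => dd time G z = laplacian G z - Q z / dot (N z) (N z))).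
  by move=> x Ox; rewrite -QE// pde.
have third u v : dd nu (dd u (dd v G)) z0 = dd u (dd v (dd nu G)) z0.
  rewrite (ddC oO (smooth_dd sG _) _ _ Oz0).
  apply: (open_eq_dd _ oO) Oz0 => y Oy.
  exact: (ddC oO sG _ _ Oy).
have dthird u v : is_derive z0 nu (dd u (dd v G)) (dd u (dd v (dd nu G)) z0).
  by rewrite -third; exact: (is_derive_dd (smooth_dd (smooth_dd sG _) _) nu Oz0).
have qE i : dd (axis i) (dd nu G) z0 = q 0 i by rewrite mxE.
have NqE j : \sum_i N0 0 i * dd (axis i) (dd (axis j) G) z0 = q 0 j.
  rewrite -qE (ddC oO sG (axis j) nu Oz0).
  rewrite (dd_space N0 (smooth_dd sG (axis j)) Oz0).
  by apply: eq_bigr => i _; congr (_ * _); rewrite mxE.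
(* Each factor [N z 0 i] has derivative [- q 0 i], and contracting the Hessian with [N0] gives [q]
   again ([NqE]), so the two factors contribute [- 2 * dot q q]. *)
have dQ : is_derive z0 nu Q
   (- 2 * dot q q + dd nu (dd nu (dd nu G)) z0).
  apply: (@is_derive_eq _ _ _ _ _ _ _
    (\sum_i \sum_j (N0 0 i * N0 0 j * dd (axis i) (dd (axis j) (dd nu G)) z0
       + dd (axis i) (dd (axis j) G) z0
          * (N0 0 i * - q 0 j + N0 0 j * - q 0 i)))).
    apply: is_derive_bigsum => i; apply: is_derive_bigsum => j.
    have := is_deriveM (is_deriveM (dN i Oz0) (dN j Oz0)) (dthird (axis i) (axis j)).
    by rewrite !qE.
  have sum1 : \sum_i \sum_j N0 0 i * N0 0 j * dd (axis i) (dd (axis j) (dd nu G)) z0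
      = dd nu (dd nu (dd nu G)) z0.
    by rewrite (dd2_space _ sGnu Oz0).
  have sum2 : \sum_i \sum_j dd (axis i) (dd (axis j) G) z0 * (N0 0 i * q 0 j)
      = dot q q.
    rewrite exchange_big; apply: eq_bigr => j _; rewrite -{3}(NqE j) mulr_sumr.
    by apply: eq_bigr => i _; ring.
  have sum3 : \sum_i \sum_j dd (axis i) (dd (axis j) G) z0 * (N0 0 j * q 0 i)
      = dot q q.
    rewrite -sum2 exchange_big; apply: eq_bigr => j _; apply: eq_bigr => i _.
    by rewrite (ddC oO sG (axis i) (axis j) Oz0).
  rewrite -sum1.
  under eq_bigr do rewrite big_split/=.
  rewrite big_split/= addrC; congr (_ + _).
  under eq_bigr => i _.
    under eq_bigr => j _.
      rewrite mulrDr !mulrN -opprD.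
    over.
    rewrite sumrN big_split/=.
  over.
  by rewrite sumrN big_split/= sum2 sum3; ring.
have dS : is_derive z0 nu (fun z => dot (N z) (N z)) (- 2 * r).
  apply: (@is_derive_eq _ _ _ _ _ _ _
    (\sum_i (N0 0 i * - q 0 i + N0 0 i * - q 0 i))).
    apply: is_derive_bigsum => i.
    by have := is_deriveM (dN i Oz0) (dN i Oz0); rewrite !qE.
  rewrite /r /dot mulr_sumr; apply: eq_bigr => i _; ring.
have dLap : is_derive z0 nu (laplacian G) (laplacian (dd nu G) z0).
  by apply: is_derive_bigsum => i; exact: dthird.
have Q0 : Q z0 = r.
  by rewrite -(QE _ Oz0) (dd_space _ sGnu Oz0).
have dI : is_derive z0 nu (fun z => (dot (N z) (N z))^-1) (- S ^- 2 * (- 2 * r)).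
  have [dS1 dS2] := dS; split; first exact: derivableV.
  by rewrite deriveV// dS2.
have -> : dd nu (fun z => laplacian G z - Q z / dot (N z) (N z)) z0 = _ :=
  is_derive_ddE (is_deriveB dLap (is_deriveM dQ dI)).
rewrite Q0 -/S -/nu.
move: (laplacian _ _) (dd nu (dd nu (dd nu G)) z0) => a b.
have scE (c d : R) : c *: d = c * d by [].
rewrite !scE; field; exact: S0.
Qed.

End EvolutionOfSlope.

(** * The barrier *)

Section SpaceTimeJets.
Context (R : realType) (m : nat).
Local Notation V := ('rV[R]_m * R)%type.
Implicit Types (z v : V).

Lemma jet2_snd z : jet2 (fun z : V => z.2) z (fun v => v.2) (fun=> 0).
Proof. by apply: jet2_linear => // y; exact: cvg_snd. Qed.

Lemma jet2_coord i z : jet2 (fun z : V => z.1 0 i) z (fun v => v.1 0 i) (fun=> 0).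
Proof.
apply: jet2_linear => [k x y /=|y]; first by rewrite !mxE.
apply: (@continuous_comp _ _ _ fst (fun x : 'rV[R]_m => x 0 i)); first exact: cvg_fst.
exact: coord_continuous.
Qed.

Lemma jet2_dot z : jet2 (fun z : V => dot z.1 z.1) z
  (fun v => 2 * dot z.1 v.1) (fun v => 2 * dot v.1 v.1).
Proof.
have [td D DD] := jet2_sum (fun i => jet2M (jet2_coord i z) (jet2_coord i z)).
split=> [|v|v]; first exact: td.
  by rewrite [LHS]D /dot mulr_sumr; apply: eq_bigr => i _; ring.
by rewrite [LHS]DD /dot mulr_sumr; apply: eq_bigr => i _; ring.
Qed.

End SpaceTimeJets.

Lemma jet2_dd (R : realType) (V : normedModType R) (O : set V) (F : V -> R) z :
  open O -> smooth O F -> O z ->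
  jet2 F z (fun v => dd v F z) (fun v => dd v (dd v F) z).
Proof.
move=> oO sF Oz; have [td _ _] := jet2_smooth oO sF Oz.
by split=> [|v|v]; rewrite -?ddE.
Qed.

Section Barrier.
Context (R : realType) (m : nat).
Local Notation V := ('rV[R]_m * R)%type.
Variables (La ka M ep : R).

(** This is [eta], arranged as sums and multiples so that the jet rules apply literally. The term
    [2 * m%:R * z.2] compensates for the second derivatives of [dot z.1 z.1]. *)
Definition barrier (G : V -> R) (z : V) : R :=
  expR (La * (ka * z.2 + (G z + - M))) +
  (- 1 + (- ep) * (dot z.1 z.1 + (2 * m%:R) * z.2)).

Variables (w : 'rV[R]_m) (O : set V) (G : V -> R) (x0 : 'rV[R]_m) (t0 : R).
Hypotheses (oO : open O) (sG : smooth O G) (Oz0 : O (x0, t0)).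
Hypothesis pde : forall x, O (x, t0) -> graph_mcf w G (x, t0).

(** At the maximum the tangential first derivatives of the product vanish, which turns the cross
    term into exactly the term of [heat_slope]; the two cancel and [L eta >= 0] remains. As
    [L G = 0] and the tangential gradient of [G] has squared length [1 - 1 / S], the exponential
    part gives the inequality. *)
Lemma barrier_touching : dot w w = 1 -> dot w (gradient G (x0, t0)) = 0 ->
  0 < La -> 0 <= ep ->
  let N0 := w - gradient G (x0, t0) in
  let f z := dot N0 (w - gradient G z) * barrier G z in
  0 < barrier G (x0, t0) ->
  (forall x, O (x, t0) -> f (x, t0) <= f (x0, t0)) ->
  (\forall h \near 0^'+, f (x0, t0 - h) <= f (x0, t0)) ->
  La * (1 - (dot N0 N0)^-1) <= ka.
Proof.
move=> w1 wG La0 ep0 N0 f eta0 fx ft; set z0 := (x0, t0) in wG N0 f eta0 fx ft *.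
pose S := dot N0 N0.
pose g := dot (gradient G z0) (gradient G z0).
have g0 : 0 <= g by exact: dot_ge0.
have Ng : dot N0 (gradient G z0) = - g by rewrite /N0 dotBl wG sub0r.
have SE : S = 1 + g.
  by rewrite /S {2}/N0 dotBr Ng opprK /N0 dotBl w1 (dotC _ w) wG subr0.
have S0 : 0 < S by rewrite SE; lra.
have Sn0 : S != 0 by rewrite gt_eqF.
pose nu := space N0.
(* Pairing with the fixed vector [N0] makes the slope factor linear in the gradient: a constant
   minus [dd nu G], whose evolution is known. *)
pose F z := (dot N0 w + (-1) * dd nu G z) * barrier G z.
have fF z : O z -> f z = F z.
  move=> Oz; rewrite /f /F; congr (_ * _).
  by rewrite dotBr (dd_space _ sG Oz) mulN1r.
have Fz0 : dot N0 w + -1 * dd nu G z0 = S.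
  by rewrite (dd_space _ sG Oz0) mulN1r -dotBr.
have sGnu : smooth O (dd nu G) by exact: smooth_dd.
have jl := jet2D (jet2_cst (dot N0 w) z0) (jet2Z (-1) (jet2_dd oO sGnu Oz0)).
have jeta := jet2D
  (jet2_expR (jet2Z La (jet2D (jet2Z ka (jet2_snd z0))
    (jet2D (jet2_dd oO sG Oz0) (jet2_cst (- M) z0)))))
  (jet2D (jet2_cst (-1) z0)
    (jet2Z (- ep) (jet2D (jet2_dot z0) (jet2Z (2 * m%:R) (jet2_snd z0))))).
have [tF DF DDF] := jet2M jl jeta; clear jl jeta.
rewrite -/(barrier G z0) in DF DDF.
rewrite Fz0 in DF DDF.
set E := expR _ in DF DDF; have E0 : 0 < E by exact: expR_gt0.
set et := barrier G z0 in eta0 DF DDF.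
have near_slice a : \forall h \near (0 : R), F (h *: space a + z0) <= F z0.
  have : \forall z \near z0, O z by exact: open_nbhs_nbhs.
  move=> /near_line -/(_ (space a)); apply: filterS => h.
  have -> : h *: space a + z0 = (h *: a + x0, t0).
    by rewrite -spaceZ /space /z0; congr pair; rewrite add0r.
  by move=> Oh; rewrite -!fF//; exact: fx.
pose b := tangent N0.
have D0 k : 'D_(b k) F z0 = 0.
  apply: derive_local_max; first exact: twice_differentiable_at tF.
  exact: near_slice.
have DD0 k : 'D_(b k) ('D_(b k) F) z0 <= 0.
  apply: derive2_local_max; [exact: tF.1|exact: tF.2|exact: near_slice].
have Dt : 0 <= 'D_time F z0.
  have dF := twice_differentiable_at tF.
  have : 'D_(- time) F z0 <= 0.
    apply: derive_right_le0; first exact: diff_derivable.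
    have : \forall z \near z0, O z by exact: open_nbhs_nbhs.
    move=> /near_line -/(_ (- time)) nO.
    have nO' : \forall h \near 0^'+, O (h *: - time + z0) by exact: cvg_within.
    near=> h.
    have Oh : O (h *: - time + z0) by near: h; exact: nO'.
    have : f (x0, t0 - h) <= f z0 by near: h; exact: ft.
    move: Oh; have -> : h *: - time + z0 = (x0, t0 - h).
      rewrite /time /z0; congr pair => /=; first by rewrite oppr0 scaler0 add0r.
      by rewrite addrC; congr (_ + _); rewrite -[LHS]/(h * - 1) mulrN1.
    by move=> Oh; rewrite !fF.
  by rewrite !deriveE// linearN oppr_le0.
have hh := heat_height oO sG Oz0 pde Sn0.
have hs := heat_slope oO sG Oz0 pde Sn0.
rewrite -/N0 -/nu -/S in hh hs.
pose p k := dd (b k) (dd nu G) z0.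
pose p2 k := dd (b k) (dd (b k) (dd nu G)) z0.
pose g1 k := dd (b k) G z0.
pose g2 k := dd (b k) (dd (b k) G) z0.
pose bb k := dot (b k).1 (b k).1.
have Q : \sum_k g1 k ^+ 2 = 1 - S^-1.
  rewrite (eq_bigr _ (fun k _ => congr1 (fun a => a ^+ 2) (dd_tangent N0 k sG Oz0))).
  by rewrite sum_sqr_tangent// Ng -/g -/S SE; field; lra.
(* The sum is the trace of a projection; bounding each term by 1 suffices against the time term of
   the barrier. *)
have B : \sum_k bb k <= m%:R.
  rewrite -[X in X%:R](card_ord m) -sumr_const; apply: ler_sum => k _.
  rewrite /bb dot_tangent//.
  by rewrite gerBl divr_ge0 ?sqr_ge0//; exact: ltW.
pose ebk k := E * (La * (g1 k)) - ep * (2 * dot x0 (b k).1).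
have D0' k : S * ebk k - et * p k = 0.
  rewrite -(D0 k) DF /= /ebk /p /g1 /z0/=.
  ring.
have DD0' k : - (p2 k * et) - 2 * (p k * ebk k) +
    S * (E * (La * g2 k + (La * g1 k) ^+ 2) - ep * (2 * bb k)) <= 0.
  apply: le_trans (DD0 k); rewrite DDF le_eqVlt; apply/orP; left; apply/eqP.
  by rewrite /= /ebk /p /p2 /g1 /g2 /bb /z0/=; ring.
have Dt' : 0 <= S * (E * (La * (ka + dd time G z0)) - ep * (2 * m%:R))
    - et * dd time (dd nu G) z0.
  apply: le_trans Dt _; rewrite DF le_eqVlt; apply/orP; left; apply/eqP.
  by rewrite /= (_ : dot x0 0 = 0); [ring|rewrite -(scale0r (0 : 'rV[R]_m)) dotZr mul0r].
have ebkE k : ebk k = et * p k / S.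
  by apply: (mulfI Sn0); rewrite mulrCA mulfV// mulr1; move: (D0' k); lra.
have : \sum_k (- (p2 k * et) - 2 * (p k * ebk k) +
    S * (E * (La * g2 k + (La * g1 k) ^+ 2) - ep * (2 * bb k))) <= 0.
  by apply: sumr_le0 => k _.
have Ek k : - (p2 k * et) - 2 * (p k * ebk k) +
    S * (E * (La * g2 k + (La * g1 k) ^+ 2) - ep * (2 * bb k)) =
    (- et) * p2 k + (- (2 * et / S)) * p k ^+ 2 + (S * E * La) * g2 k
    + (S * E * La ^+ 2) * g1 k ^+ 2 + (- (2 * S * ep)) * bb k.
  by rewrite ebkE; field.
rewrite (eq_bigr _ (fun k _ => Ek k)) !big_split/= -!mulr_sumr Q.
move: hh hs; rewrite -/(p2 _).
move=> /eqP; rewrite subr_eq0 => /eqP hh.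
move=> /eqP; rewrite subr_eq => /eqP hs.
move: Dt'; rewrite hh hs -/b.
rewrite -[\sum_(k < m) dd (b k) (dd (b k) G) z0]/(\sum_(k < m) g2 k).
rewrite -[\sum_(k < m) dd (b k) (dd (b k) (dd nu G)) z0]/(\sum_(k < m) p2 k).
rewrite -[\sum_(k < m) dd (b k) (dd nu G) z0 ^+ 2]/(\sum_(k < m) p k ^+ 2).
move: (\sum_(k < m) g2 k) (\sum_(k < m) p2 k) (\sum_(k < m) p k ^+ 2) B.
move: (\sum_(k < m) bb k) => sb sg sp2 sp B A1 A2.
have A3 : 0 <= S * (E * La * (ka - La * (1 - S^-1)) - 2 * ep * (m%:R - sb)).
  have A0 := le_trans A2 A1; rewrite -subr_ge0 in A0.
  by apply: etrans A0; congr (0 <= _); field.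
rewrite pmulr_rge0// subr_ge0 in A3.
have A4 : 0 <= E * La * (ka - La * (1 - S^-1)).
  by apply: le_trans A3; apply: mulr_ge0; rewrite ?subr_ge0//; apply: mulr_ge0.
by rewrite pmulr_rge0 ?mulr_gt0// subr_ge0 in A4.
Unshelve. all: by end_near. Qed.

End Barrier.

(** * The maximum principle *)

Section SlopeBound.
Context (R : realType) (m : nat).
Local Notation V := ('rV[R]_m * R)%type.
Variables (w : 'rV[R]_m) (T M : R) (U : 'rV[R]_m -> R -> R).

(* [G] extends [U] smoothly across the ends of the time interval. *)
Definition local_solution (O : set V) (G : V -> R) : Prop :=
  [/\ open O, smooth O G,
      forall z, O z -> 0 <= z.2 <= T -> G z = U z.1 z.2,
      forall z, O z -> 0 <= z.2 <= T -> dot w (gradient G z) = 0 &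
      forall z, O z -> 0 <= z.2 <= T -> graph_mcf w G z].

(** Defined from [U] alone, so that one function on a whole box can be maximised; smoothness is
    borrowed from a local extension at each point. *)
Let DU (z : V) : 'rV[R]_m := \row_i 'D_(delta_mx 0 i) (U^~ z.2) z.1.

Lemma local_gradient O G z : local_solution O G -> O z -> 0 <= z.2 <= T ->
  gradient G z = DU z.
Proof.
move=> [oO sG GU _ _]; case: z => x t Oz /= tT.
apply/rowP => i; rewrite !mxE -ddE; apply: derive_slice => /=.
have : \forall z \near (x, t), O z by exact: open_nbhs_nbhs.
move=> /near_line -/(_ (axis i)); apply: filterS => h.
have -> : h *: axis i + (x, t) = (h *: delta_mx 0 i + x, t).
  by rewrite /axis -spaceZ /space; congr pair; rewrite add0r.
by move=> Oh; rewrite GU.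
Qed.

Lemma jet2_slope_sqr O G z : open O -> smooth O G -> O z ->
  exists d1 d2, jet2 (fun z => dot (w - gradient G z) (w - gradient G z)) z d1 d2.
Proof.
move=> oO sG Oz.
have ji i := jet2D (jet2_cst (w 0 i) z)
  (jet2Z (-1) (jet2_dd oO (smooth_dd sG (axis i)) Oz)).
have js := jet2_sum (fun i => jet2M (ji i) (ji i)).
do 2! eexists; apply: jet2_eq js => y.
by apply: eq_bigr => i _; rewrite !mxE mulN1r.
Qed.

Lemma jet2_barrier La ka ep O (G : V -> R) z : open O -> smooth O G -> O z ->
  exists d1 d2, jet2 (barrier La ka M ep G) z d1 d2.
Proof.
move=> oO sG Oz; do 2! eexists; exact: (jet2D
  (jet2_expR (jet2Z La (jet2D (jet2Z ka (jet2_snd z))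
    (jet2D (jet2_dd oO sG Oz) (jet2_cst (- M) z)))))
  (jet2D (jet2_cst (-1) z)
    (jet2Z (- ep) (jet2D (jet2_dot z) (jet2Z (2 * m%:R) (jet2_snd z)))))).
Qed.

Lemma jet2_continuous (f : V -> R) z d1 d2 : jet2 f z d1 d2 -> {for z, continuous f}.
Proof.
by move=> [tf _ _]; apply: differentiable_continuous; exact: twice_differentiable_at.
Qed.

Hypothesis w1 : dot w w = 1.
Hypothesis UM : forall x t, 0 <= t <= T -> `|U x t| < M.
Hypothesis loc : forall x t, 0 <= t <= T ->
  exists O G, local_solution O G /\ O (x, t).

(** By contradiction. If the slope at [(x1, t1)] exceeds [2 * B], so does slope times [eta] for
    small [ep]. A maximum of this product over a compact box has slope above 2, positive time, and
    lies away from the lateral boundary, against [barrier_touching]. *)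
Lemma slope_bound O G x1 t1 : local_solution O G -> O (x1, t1) ->
  0 < t1 <= T -> t1 <= 6 * M ^+ 2 ->
  Num.sqrt (dot (w - gradient G (x1, t1)) (w - gradient G (x1, t1))) <=
    2 * expR (18 * M ^+ 2 / t1).
Proof.
move=> locG Oz1 /andP[t10 t1T] t1M; rewrite leNgt; apply/negP.
set N := w - _ => big.
have M0 : 0 < M.
  by apply: le_lt_trans (UM x1 (_ : 0 <= t1 <= T)); rewrite ?normr_ge0// ltW.
(* With [ka * t1 = 3 * M] and [|U| < M], the exponent stays below [La * 3 * M = 18 * M ^+ 2 / t1] up
   to time [t1], where it exceeds [La * M = 6 * M ^+ 2 / t1 >= 1]. *)
pose ka := 3 * M / t1; pose La := 2 * ka.
pose B := expR (18 * M ^+ 2 / t1).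
have ka0 : 0 < ka by rewrite divr_gt0 ?mulr_gt0.
have La0 : 0 < La by rewrite mulr_gt0.
have B0 : 0 < B := expR_gt0 _.
pose v1 := Num.sqrt (dot N N).
have v1B : 2 * B < v1 by exact: big.
have v10 : 0 < v1 by lra.
pose q1 := dot x1 x1 + (2 * m%:R) * t1.
have q10 : 0 <= q1.
  by rewrite addr_ge0 ?dot_ge0// mulr_ge0 ?mulr_ge0// ltW.
(* Makes [v1 * (1 - de)] the midpoint of [v1] and [2 * B]; then [ep] is so small that its term in
   [eta] costs at most [de] at [(x1, t1)]. *)
pose de := (v1 - 2 * B) / (2 * v1).
have de0 : 0 < de by rewrite divr_gt0 ?subr_gt0 ?mulr_gt0.
pose ep := de / (q1 + 1).
have ep0 : 0 < ep by rewrite divr_gt0// ltr_wpDl.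
have epq : ep * q1 <= de.
  by rewrite /ep mulrAC ler_pdivrMr ?ltr_wpDl// ler_pM2l// lerDl.
(* Up to time [t1], [eta > 0] forces [dot x x < B / ep < rho]. As [rho >= 1], also
   [rho <= rho ^+ 2], and the ball of radius [rho] lies in the box [K]; the summand [dot x1 x1]
   brings [x1] into it. *)
pose rho := dot x1 x1 + B / ep + 1.
have Bep : 0 < B / ep by rewrite divr_gt0.
have rho1 : 1 <= rho by rewrite /rho; have := dot_ge0 x1; lra.
have rho2 : rho <= rho ^+ 2 by rewrite expr2 ler_peMr//; lra.
pose eta := barrier La ka M ep (fun z : V => U z.1 z.2).
pose Phi z := Num.sqrt (dot (w - DU z) (w - DU z)) * eta z.
pose K : set V :=
  [set x : 'rV[R]_m | forall i, `[- rho, rho]%classic (x ord0 i)] `*` `[0, t1]%classic.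
have KI x t : dot x x < rho ^+ 2 -> 0 <= t <= t1 -> K (x, t).
  move=> xr tt; split=> [i /=|/=]; last by rewrite in_itv.
  rewrite in_itv/= -ler_norml -(@ler_pXn2r _ 2) ?nnegrE//; last by lra.
  rewrite real_normK ?num_real//; apply: le_trans (ltW xr).
  by rewrite /dot (bigD1 i)//= -expr2 lerDl sumr_ge0// => j _; rewrite -expr2 sqr_ge0.
have KT z : K z -> 0 <= z.2 <= t1.
  by case: z => x t [_] /=; rewrite in_itv.
have KT' z : K z -> 0 <= z.2 <= T.
  by move=> /KT /andP[-> /=] zt; exact: le_trans t1T.
have eta_local D G' z : local_solution D G' -> D z -> 0 <= z.2 <= T ->
    barrier La ka M ep G' z = eta z.
  by move=> [_ _ GU _ _] Oz zT; rewrite /eta /barrier GU.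
have cPhi : {within K, continuous Phi}.
  apply/subspace_continuousP => -[x t] Kz.
  have [D [G' [lG Oz]]] := loc x (KT' _ Kz).
  have [oO sG _ _ _] := lG.
  pose P z := Num.sqrt (dot (w - gradient G' z) (w - gradient G' z)) *
    barrier La ka M ep G' z.
  have EP z : D z -> K z -> P z = Phi z.
    by move=> Dz /KT' zT; rewrite /P /Phi (local_gradient lG)// (eta_local D G').
  have cP : {for (x, t), continuous P}.
    have [d1 [d2 js]] := jet2_slope_sqr oO sG Oz.
    have [e1 [e2 jb]] := jet2_barrier La ka ep oO sG Oz.
    apply: continuousM; last exact: jet2_continuous jb.
    apply: continuous_comp; first exact: jet2_continuous js.
    exact: sqrt_continuous.
  suff : Phi @ within K (nbhs (x, t)) --> Phi (x, t) by [].
  rewrite -(EP _ Oz Kz); 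
  have cP' : P @ within K (nbhs (x, t)) --> P (x, t) by exact: cvg_within_filter cP.
  apply: cvg_trans cP'.
  apply: near_eq_cvg.
  rewrite near_withinE.
  have : \forall z \near (x, t), D z by exact: open_nbhs_nbhs.
  by apply: filterS => z; exact: EP.
have cK : compact K.
  apply: compact_setX; last exact: segment_compact.
  apply: (@rV_compact _ _ (fun=> `[- rho, rho]%classic)) => i.
  exact: segment_compact.
have K1 : K (x1, t1).
  apply: KI; last by rewrite lexx ltW.
  by apply: lt_le_trans rho2; rewrite /rho; lra.
have [z0 Kz0 max0] := compact_EVT_max (ex_intro _ _ K1) cK cPhi.
rewrite inE in Kz0.
have E1 : 2 <= expR (La * (ka * t1 + (U x1 t1 + - M))).
  have k1 : ka * t1 = 3 * M by rewrite /ka divfK// gt_eqF.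
  have : 1 <= La * (ka * t1 + (U x1 t1 + - M)).
    have : 1 <= La * M.
      rewrite /La /ka; have -> : 2 * (3 * M / t1) * M = 6 * M ^+ 2 / t1 by field; lra.
      by rewrite ler_pdivlMr// mul1r.
    move/le_trans; apply; rewrite ler_pM2l// k1.
    have := UM x1 (_ : 0 <= t1 <= T); rewrite (ltW t10) t1T => /(_ isT).
    by rewrite ltr_norml => /andP[+ _]; lra.
  by move=> h; apply: le_trans (expR_ge1Dx _); lra.
have Phi1 : 2 * B < Phi (x1, t1).
  have e1 : 1 - de <= eta (x1, t1).
    by rewrite /eta /barrier /= -/q1 mulNr; lra.
  rewrite /Phi -(local_gradient locG Oz1) /= -/N -/v1; last by rewrite ltW.
  apply: lt_le_trans (_ : v1 * (1 - de) <= _); last by rewrite ler_pM2l.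
  have -> : v1 * (1 - de) = (v1 + 2 * B) / 2 by rewrite /de; field; lra.
  lra.
have Phi0 : 2 * B < Phi z0.
  by apply: lt_le_trans Phi1 _; apply: max0; rewrite inE.
have etaB z : K z -> eta z < B - ep * dot z.1 z.1.
  move=> Kz; have /andP[z0' z1] := KT _ Kz.
  have := UM z.1 (KT' _ Kz); rewrite ltr_norml => /andP[_ uM].
  have : expR (La * (ka * z.2 + (U z.1 z.2 + - M))) <= B.
    rewrite ler_expR.
    have -> : 18 * M ^+ 2 / t1 = La * (ka * t1) by rewrite /La /ka; field; lra.
    rewrite ler_pM2l//; have : ka * z.2 <= ka * t1 by rewrite ler_pM2l.
    lra.
  have : 0 <= ep * ((2 * m%:R) * z.2).
    by apply: mulr_ge0; [exact: ltW|rewrite mulr_ge0// mulr_ge0].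
  by rewrite /eta /barrier mulNr mulrDr; lra.
have sq0 : 0 <= Num.sqrt (dot (w - DU z0) (w - DU z0)) by exact: sqrtr_ge0.
have eta0 : 0 < eta z0.
  rewrite ltNge; apply/negP => e0.
  have : Phi z0 <= 0 by rewrite /Phi mulr_ge0_le0.
  by lra.
case: z0 Kz0 max0 Phi0 sq0 eta0 => x0 t0 Kz0 max0 Phi0 sq0 eta0.
have /andP[t00 t0t1] := KT _ Kz0; rewrite /= in t00 t0t1.
(* The product exceeds [2 * B] while [eta < B]. *)
have S2 : 2 < Num.sqrt (dot (w - DU (x0, t0)) (w - DU (x0, t0))).
  rewrite ltNge; apply/negP => s2; have := etaB _ Kz0.
  have : 0 <= ep * dot x0 x0 by rewrite mulr_ge0 ?dot_ge0// ltW.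
  move=> /= p1 p2.
  have : Phi (x0, t0) <= 2 * eta (x0, t0) by rewrite /Phi ler_wpM2r// ltW.
  by lra.
have x0rho : dot x0 x0 < rho ^+ 2.
  apply: lt_le_trans rho2; apply: lt_trans (_ : B / ep < rho).
    by rewrite ltr_pdivlMr// mulrC; have := etaB _ Kz0; rewrite /=; lra.
  by rewrite /rho; have := dot_ge0 x1; lra.
(* At time 0 the exponent is [La * (U - M) < 0], so [eta] is negative there. *)
have t0pos : 0 < t0.
  rewrite lt_def t00 andbT; apply/eqP => t0E.
  suff : eta (x0, t0) < 0 by lra.
  rewrite /eta /barrier /= t0E !mulr0 addr0 add0r mulNr.
  have : 0 <= ep * dot x0 x0 by rewrite mulr_ge0 ?dot_ge0// ltW.
  have : expR (La * (U x0 0 + - M)) < 1.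
    rewrite -expR0 ltr_expR pmulr_rlt0//.
    have := UM x0 (_ : 0 <= 0 <= T); rewrite lexx (le_trans (ltW t10) t1T) => /(_ isT).
    by rewrite ltr_norml => /andP[_]; lra.
  by lra.
have t0T : 0 <= t0 <= T by rewrite t00 (le_trans t0t1).
have [D [G' [lG Oz]]] := loc x0 t0T.
have [oO sG GU Gw Gpde] := lG.
(* Positivity of the barrier is included so that the Cauchy-Schwarz inequality can be multiplied by
   it. *)
pose P := [set z : V | [/\ D z, dot z.1 z.1 < rho ^+ 2 & 0 < barrier La ka M ep G' z]].
have P0 : P° (x0, t0).
  have etaG : 0 < barrier La ka M ep G' (x0, t0) by rewrite (eta_local D).
  have [d1 [d2 jb]] := jet2_barrier La ka ep oO sG Oz.
  have [jd _ _] := jet2_dot (x0, t0).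
  have cb := jet2_continuous jb.
  have cd := differentiable_continuous (twice_differentiable_at jd).
  have nD : \forall z \near (x0, t0), D z by exact: open_nbhs_nbhs.
  have nb : \forall z \near (x0, t0), 0 < barrier La ka M ep G' z.
    by exact: cvgr_gt cb _ etaG.
  have nd : \forall z \near (x0, t0), dot z.1 z.1 < rho ^+ 2 by exact: cvgr_lt cd _ x0rho.
  by have : \forall z \near (x0, t0), P z by near do split.
have PO : P° `<=` D by move=> z /interior_subset [].
(* [dot N0 N <= |N0| |N|], with equality at [(x0, t0)], passes maximality from [Phi] to the product
   that is linear in the gradient. *)
have Gmax z : P° z -> 0 <= z.2 <= t0 ->
    dot (w - gradient G' (x0, t0)) (w - gradient G' z) * barrier La ka M ep G' z <=
    dot (w - gradient G' (x0, t0)) (w - gradient G' (x0, t0)) *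
      barrier La ka M ep G' (x0, t0).
  case: z => x t /interior_subset[Dz /= xr bpos] tt.
  have tt1 : 0 <= t <= t1.
    by move: tt => /andP[-> /= tt]; exact: le_trans t0t1.
  have Kz := KI _ _ xr tt1.
  rewrite !(eta_local D)//; last exact: KT' Kz.
  rewrite !(local_gradient lG)//; last exact: KT' Kz.
  have bpos' : 0 <= eta (x, t) by rewrite -(eta_local D G' _ lG Dz (KT' _ Kz)) ltW.
  set a := w - DU (x0, t0); set b := w - DU (x, t).
  have cs : dot a b <= Num.sqrt (dot a a) * Num.sqrt (dot b b).
    rewrite -sqrtrM ?dot_ge0//; apply: le_trans (ler_norm _) _.
    by rewrite -sqrtr_sqr ler_wsqrtr// cauchy_schwarz.
  apply: le_trans (ler_wpM2r bpos' cs) _.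
  rewrite -mulrA -[X in _ <= X * _](@sqr_sqrtr _ (dot a a)) ?dot_ge0// expr2 -mulrA.
  by rewrite ler_wpM2l// ?sqrtr_ge0//; apply: max0; rewrite inE.
have := @barrier_touching _ _ La ka M ep w P° G' x0 t0 (@open_interior _ _)
  (smooth_subset PO sG) P0 _ w1 (Gw _ Oz t0T) La0 (ltW ep0).
rewrite (eta_local D)// => /(_ _ eta0).
have pde x : P° (x, t0) -> graph_mcf w G' (x, t0).
  by move=> /PO Dx; exact: Gpde.
move=> /(_ pde) touch.
have : La * (1 - (dot (w - gradient G' (x0, t0)) (w - gradient G' (x0, t0)))^-1) <= ka.
  apply: touch.
    by move=> x Px; apply: Gmax => //=; rewrite t00 lexx.
  have nP : \forall z \near (x0, t0), P° z by exact: nbhs_interior.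
  move: nP => /near_line -/(_ (- time)) nP.
  have nP' : \forall h \near 0^'+, P° (h *: - time + (x0, t0)) by exact: cvg_within.
  near=> h.
  have h0 : 0 < h by [].
  have ht : h <= t0 by near: h; exact: nbhs_right_le.
  have Ph : P° (h *: - time + (x0, t0)) by near: h; exact: nP'.
  apply: Gmax => /=; last first.
    by rewrite subr_ge0 ht gerBl ltW.
  move: Ph; congr (P° _); congr pair => /=; first by rewrite oppr0 scaler0 add0r.
  by rewrite addrC; congr (_ + _); rewrite -[LHS]/(h * - 1) mulrN1.
(* As [La = 2 * ka], the inequality says [1 - 1 / s <= 1 / 2], whereas [s > 4]. *)
rewrite (local_gradient lG)// /La mulrAC ger_pMl//.
set s := dot _ _ in S2 *.
have s4 : 4 < s.
  have s0 : 0 <= s by exact: dot_ge0.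
  rewrite -(sqr_sqrtr s0); have -> : 4 = 2 ^+ 2 :> R by ring.
  by rewrite ltr_pXn2r ?nnegrE ?sqrtr_ge0.
apply/negP; rewrite -ltNge.
have : s^-1 < 4^-1 by rewrite ltf_pV2 ?posrE//; lra.
lra.
Unshelve. all: by end_near. Qed.
End SlopeBound.

(** * From the parametrized flow to its graph *)

Section GramMatrix.
Context (R : realType) (n : nat).
Implicit Types (J : 'M[R]_(n, n.+1)) (N : 'rV[R]_n.+1).

Lemma gram_unit J : row_free J -> J *m J^T \in unitmx.
Proof.
move=> Jf; rewrite -row_free_unit; apply: inj_row_free => v vJ.
apply: (row_free_inj Jf); rewrite mul0mx; apply/eqP.
by rewrite -dot_eq0 dot_mx trmx_mul mulmxA -[v *m J *m _]mulmxA vJ mul0mx mxE.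
Qed.

(** Both sides are the orthogonal projection onto the row space of [J]: they agree on the rows of
    [J] and on [N], which together form a basis. *)
Lemma tangent_projection J N : row_free J -> J *m N^T = 0 -> dot N N != 0 ->
  J^T *m invmx (J *m J^T) *m J = 1%:M - (dot N N)^-1 *: (N^T *m N).
Proof.
move=> Jf JN N0; have Ju := gram_unit Jf.
have NJ : N *m J^T = 0 by rewrite -[LHS]trmxK trmx_mul trmxK JN trmx0.
have NN : N *m N^T = (dot N N)%:M by rewrite [LHS]mx11_scalar -dot_mx.
pose C := col_mx J N.
have Cf : row_free C.
  apply: inj_row_free => v; rewrite -[v]hsubmxK mul_row_col => E.
  have r0 : rsubmx v = 0.
    have := congr1 (mulmx^~ N^T) E.
    rewrite mulmxDl -!mulmxA JN mulmx0 add0r NN mul0mx mul_mx_scalar => /eqP.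
    by rewrite scaler_eq0 (negbTE N0) => /eqP.
  rewrite r0 mul0mx addr0 in E.
  have -> : lsubmx v = 0 by apply: (row_free_inj Jf); rewrite E mul0mx.
  by rewrite r0 row_mx0.
have Cfull : row_full C by rewrite /row_full (eqP Cf) addn1.
apply: (row_full_inj Cfull).
rewrite mulmxBr mulmx1 /C !mul_col_mx !mulmxA NJ !mul0mx mulmxV// mul1mx.
rewrite -!scalemxAr !mulmxA JN NN mul0mx mul_scalar_mx scaler0 scalerA mulVf//.
by rewrite scale1r opp_col_mx add_col_mx oppr0 addr0 subrr.
Qed.

Lemma dot_normal_part (X : 'rV[R]_n -> 'rV[R]_n.+1) x N a :
  jacobian X x *m N^T = 0 -> dot (normal_part X x a) N = dot a N.
Proof.
by move=> JN; rewrite dotBl [X in _ - X]dot_mx -!mulmxA JN !mulmx0 mxE subr0.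
Qed.

End GramMatrix.

(** * One-sided time derivatives on a closed interval *)

Section OneSidedDerivative.
Context (R : realType) (W : normedModType R) (T t : R).
Hypotheses (T0 : 0 < T) (tT : 0 <= t <= T).

(** Makes limits along this filter unique: [t] is approached by other points of the interval, from
    the right if [t < T] and from the left if [t = T], as [T > 0]. *)
Lemma within_itv_proper : ProperFilter (within `[0, T] t^').
Proof.
split; last exact: within_filter.
rewrite /within /dnbhs /= => /nbhs_ballP[e /= e0 He].
have [s [st sT se]] : exists s, [/\ s != t, 0 <= s <= T & `|t - s| < e].
  have /andP[t0 tT'] := tT.
  have [tltT|Tlet] := ltP t T.
    exists (t + Num.min (e / 2) (T - t)).
    have m0 : 0 < Num.min (e / 2) (T - t) by rewrite lt_min divr_gt0// subr_gt0.
    have me : Num.min (e / 2) (T - t) <= e / 2 by rewrite ge_min lexx.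
    have mT : Num.min (e / 2) (T - t) <= T - t by rewrite ge_min lexx orbT.
    move: (Num.min _ _) m0 me mT => d d0 de dT; split.
    - by rewrite gt_eqF// ltrDl.
    - by apply/andP; split; lra.
    - by rewrite opprD addNKr normrN gtr0_norm//; lra.
  exists (t - Num.min (e / 2) t).
  have m0 : 0 < Num.min (e / 2) t by rewrite lt_min divr_gt0//= (lt_le_trans T0).
  have me : Num.min (e / 2) t <= e / 2 by rewrite ge_min lexx.
  have mT : Num.min (e / 2) t <= t by rewrite ge_min lexx orbT.
  move: (Num.min _ _) m0 me mT => d d0 de dT; split.
  - by rewrite lt_eqF// gtrBl.
  - by apply/andP; split; lra.
  - by rewrite opprB addrC subrK gtr0_norm//; lra.
by apply: (He s) => //=; rewrite in_itv.
Qed.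

Lemma derivable_within (f : R -> W) : derivable f t 1 ->
  (s - t)^-1 *: (f s - f t) @[s --> within `[0, T] t^'] --> 'D_1 f t.
Proof.
move=> df.
have fd : (s - t)^-1 *: (f s - f t) @[s --> t^'] --> 'D_1 f t.
  apply/cvgrPdist_lt => e e0; move/cvgrPdist_lt : df => /(_ e e0).
  move=> [d /= d0 Hd]; exists d => //= s sd st.
  have := Hd (s - t); rewrite /= !sub0r normrN -normrN opprB => /(_ sd).
  by rewrite subr_eq0 => /(_ st); rewrite [_%:A]mulr1 subrK.
exact: cvg_within_filter fd.
Qed.

Lemma derive_within (f : R -> W) l : derivable f t 1 ->
  (s - t)^-1 *: (f s - f t) @[s --> within `[0, T] t^'] --> l -> 'D_1 f t = l.
Proof.
move=> df fl; have PF := within_itv_proper.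
exact: (cvg_unique (@norm_hausdorff _ _) (derivable_within df) fl).
Qed.

(** At an end of the interval the functions agree on one side only; the one-sided limit already
    determines the derivative. *)
Lemma derive_within_eq (f g : R -> W) : derivable f t 1 -> derivable g t 1 ->
  (\forall s \near t, 0 <= s <= T -> f s = g s) -> 'D_1 f t = 'D_1 g t.
Proof.
move=> df dg fg.
have PF := within_itv_proper.
apply: derive_within => //; apply: cvg_trans (derivable_within dg).
apply: near_eq_cvg.
have ft : f t = g t := nbhs_singleton fg tT.
rewrite ft /within /dnbhs/=; apply: filterS fg => s fg _ /=.
by rewrite in_itv => /fg ->.
Qed.

End OneSidedDerivative.

Section CoordinateFunctions.
Context (R : realType) (V : normedModType R) (m : nat) (O : set V).
Variable g : V -> 'rV[R]_m.
Hypothesis oO : open O.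

Lemma differentiable_coord_comp (f : V -> 'rV[R]_m) z j : differentiable f z ->
  differentiable (fun y => f y 0 j) z.
Proof.
move=> df; apply: (@differentiable_comp _ _ _ _ f (fun x : 'rV[R]_m => x 0 j)) => //.
exact: differentiable_coord.
Qed.

Lemma derive_coord (f : V -> 'rV[R]_m) z v j : differentiable f z ->
  'D_v (fun y => f y 0 j) z = ('D_v f z) 0 j.
Proof.
by move=> df; rewrite derive_mx ?mxE//; exact: diff_derivable.
Qed.

Lemma smooth_coord j : smooth O g -> smooth O (fun y => g y 0 j).
Proof.
move=> sg k; elim: k g sg => [|k IH] f sf /=.
  move=> x Ox; apply: (@continuous_comp _ _ _ f (fun x : 'rV[R]_m => x 0 j)).
    exact: (sf 0%N).
  exact: coord_continuous.
split=> [x Ox|v].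
  by apply: differentiable_coord_comp; exact: smooth_differentiable sf Ox.
apply: (@Ck_eq _ _ _ _ _ (fun y => ('D_v f y) 0 j)) => //.
  by move=> y Oy; rewrite derive_coord//; exact: smooth_differentiable sf Oy.
by apply: IH; exact: smooth_derive.
Qed.

End CoordinateFunctions.

Lemma dd_eq_line (R : realType) (V : normedModType R) (f g : V -> R) x v :
  (\forall h \near (0 : R), f (h *: v + x) = g (h *: v + x)) ->
  dd v f x = dd v g x.
Proof. by rewrite -!ddE; exact: derive_eq_line. Qed.

Lemma is_derive_time (R : realType) n (W : normedModType R) (f : 'rV[R]_n * R -> W)
    (x : 'rV[R]_n) (t : R) d :
  is_derive (x, t) time f d -> is_derive t 1 (fun s => f (x, s)) d.
Proof.
have E : (fun h : R => f (h *: time + (x, t))) = (fun h : R => f (x, h *: 1 + t)).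
  apply/funext => h; congr (f _); congr pair => /=.
  by rewrite scaler0 add0r.
move=> [df <-]; split.
  apply: (iffRL (derivable1P (fun s : R => f (x, s)) t 1)); rewrite -E.
  exact: (iffLR (derivable1P f (x, t) time)).
by rewrite derive_lineE [RHS]derive_lineE E.
Qed.

Lemma reverse_sum4 (R : realType) (I J : finType) (f : I -> I -> J -> J -> R) :
  \sum_k \sum_l \sum_j \sum_i f k l j i = \sum_i \sum_j \sum_l \sum_k f k l j i.
Proof.
have rev3 l : \sum_k \sum_j \sum_i f k l j i = \sum_i \sum_j \sum_k f k l j i.
  rewrite exchange_big [RHS]exchange_big; apply: eq_bigr => j _.
  by rewrite exchange_big.
rewrite exchange_big (eq_bigr _ (fun l _ => rev3 l)) exchange_big.
by apply: eq_bigr => i _; rewrite exchange_big.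
Qed.

Section Jacobian.
Context (R : realType) (n m : nat).
Implicit Types (X Y : 'rV[R]_n -> 'rV[R]_m).

Lemma jacobianE X x : differentiable X x ->
  jacobian X x = \matrix_(k, j) ('D_(delta_mx 0 k) X x) 0 j.
Proof.
move=> dX; apply/row_matrixP => k.
by rewrite rowE -deriveEjacobian//; apply/rowP => j; rewrite !mxE.
Qed.

End Jacobian.

Lemma mean_curvature_near_eq (R : realType) n (X Y : 'rV[R]_n -> 'rV[R]_n.+1) x :
  (\forall y \near x, X y = Y y) -> differentiable X x -> differentiable Y x ->
  jacobian X x = jacobian Y x /\
  mean_curvature_vector X x = mean_curvature_vector Y x.
Proof.
move=> XY dX dY.
have D k : 'D_(delta_mx 0 k) X x = 'D_(delta_mx 0 k) Y x by exact: near_eq_derive.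
have E : jacobian X x = jacobian Y x.
  rewrite (jacobianE dX) (jacobianE dY).
  by apply/matrixP => k j; rewrite !mxE D.
have P k l : partial k (partial l X) x = partial k (partial l Y) x.
  rewrite /partial; apply: near_eq_derive.
  apply: filterS (nbhs_interior XY) => y; exact: near_eq_derive.
split; first exact: E.
apply: eq_bigr => k _; apply: eq_bigr => l _.
by rewrite /normal_part /metric E P.
Qed.

(** * The flow equation of the height, computed in a chart *)

Section GraphicalFlow.
Context (R : realType) (n : nat).
Variables (w : 'rV[R]_n.+1) (T : R).
Variables (D : set ('rV[R]_n * R)) (g : 'rV[R]_n * R -> 'rV[R]_n.+1).
Variables (O : set ('rV[R]_n.+1 * R)) (G : 'rV[R]_n.+1 * R -> R).
Hypotheses (oD : open D) (sg : smooth D g) (oO : open O) (sG : smooth O G).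

Let Psi (y : 'rV[R]_n * R) : 'rV[R]_n.+1 * R := (g y, y.2).

Let dPsi y : D y -> differentiable Psi y.
Proof.
move=> Dy; apply: differentiable_pair; first exact: smooth_differentiable sg Dy.
by apply: linear_differentiable => z; exact: cvg_snd.
Qed.

Lemma is_derive_along_flow (F : 'rV[R]_n.+1 * R -> R) y v :
  smooth O F -> D y -> O (Psi y) ->
  is_derive y v (fun y => F (Psi y)) (dd (dd v g y, v.2) F (Psi y)).
Proof.
move=> sF Dy OPsi.
have dg : differentiable g y by exact: smooth_differentiable sg Dy.
have ds : differentiable (snd : 'rV[R]_n * R -> R) y.
  by apply: linear_differentiable => z; exact: cvg_snd.
have dF : differentiable F (Psi y) by exact: smooth_differentiable sF OPsi.
rewrite -!ddE; apply: is_derive_comp => //.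
apply: DeriveDef; first exact/diff_derivable/dPsi.
rewrite (deriveE _ (dPsi Dy)) (deriveE _ dg) diff_pair//=; congr pair.
rewrite diff_lin// => z; exact: cvg_snd.
Qed.

Lemma dd_coord j v y : D y -> dd v (fun y => g y 0 j) y = (dd v g y) 0 j.
Proof. by rewrite -!ddE => Dy; apply: derive_coord; exact: smooth_differentiable sg Dy. Qed.

Variables (x0 : 'rV[R]_n) (t : R).
Let y0 : 'rV[R]_n * R := (x0, t).
Hypotheses (Dy0 : D y0) (OPsi0 : O (Psi y0)).

Lemma near_domain : \forall y \near y0, D y /\ O (Psi y).
Proof.
have nD : \forall y \near y0, D y by exact: open_nbhs_nbhs.
have nO : \forall z \near Psi y0, O z by exact: open_nbhs_nbhs.
have cPsi : Psi y @[y --> y0] --> Psi y0.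
  exact: differentiable_continuous (dPsi Dy0).
by have nPsi := cPsi _ nO; near do split.
Unshelve. all: by end_near. Qed.

Let dslice x : differentiable (fun x : 'rV[R]_n => (x, t)) x.
Proof.
apply: differentiable_pair; first exact: ex_diff.
exact: differentiable_cst.
Qed.

Let cvg_slice : (x, t) @[x --> x0] --> y0.
Proof. exact: differentiable_continuous (dslice x0). Qed.

Let near_domain_slice : \forall x \near x0, D (x, t) /\ O (Psi (x, t)).
Proof. exact: cvg_slice near_domain. Qed.

Hypothesis graph_slice : \forall x \near x0, G (g (x, t), t) = dot (g (x, t)) w.

Let N z := w - gradient G z.

Let near_slice (P : 'rV[R]_n -> Prop) x k : nbhs x P ->
  \forall h \near (0 : R), exists x', h *: axis k + (x, t) = (x', t) /\ P x'.
Proof.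
move=> nP; have := near_line (delta_mx 0 k) nP; apply: filterS => h Ph.
exists (h *: delta_mx 0 k + x); split=> //.
by rewrite /axis -spaceZ /space; congr pair; rewrite add0r.
Qed.

Lemma dd_height y v : D y -> is_derive y v (fun y => dot (g y) w) (dot (dd v g y) w).
Proof.
move=> Dy; apply: is_derive_bigsum => j.
have := is_deriveM (is_derive_dd (smooth_coord oD j sg) v Dy) (is_derive_cst (w 0 j) y v).
rewrite dd_coord// => /is_derive_eq; apply.
by rewrite /cst scaler0 add0r [LHS]mulrC.
Qed.

(** Differentiates [G (g (x, t), t) = dot (g (x, t)) w] in the [k]-th coordinate. *)
Lemma near_orthogonal : \forall x \near x0, forall k,
  dot (dd (axis k) g (x, t)) (N (Psi (x, t))) = 0.
Proof.
near=> x; move=> k.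
have [Dx Ox] : D (x, t) /\ O (Psi (x, t)) by near: x; exact: near_domain_slice.
have gx : \forall x' \near x, G (g (x', t), t) = dot (g (x', t)) w.
  by near: x; exact: nbhs_interior graph_slice.
have : dd (axis k) (fun y => G (Psi y)) (x, t) = dd (axis k) (fun y => dot (g y) w) (x, t).
  apply: dd_eq_line.
  by have := near_slice k gx; apply: filterS => h [x' [-> <-]].
rewrite (is_derive_ddE (is_derive_along_flow (axis k) sG Dx Ox)).
rewrite (is_derive_ddE (dd_height (axis k) Dx)) /= -/(space _) (dd_space _ sG Ox).
by rewrite dotBr => ->; rewrite subrr.
Unshelve. all: by end_near. Qed.

Let z0 := Psi y0.
Let gk k := dd (axis k) g y0.

(** Differentiates the orthogonality of [dd (axis k) g] and [N] along [axis l]; the derivative of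
    [N] is minus the Hessian of [G], so the second fundamental form becomes that Hessian on tangent
    vectors. *)
Lemma second_fundamental_form k l :
  \sum_j N z0 0 j * dd (axis l) (dd (axis k) (fun y => g y 0 j)) y0 =
  \sum_j gk k 0 j * \sum_i gk l 0 i * dd (axis i) (dd (axis j) G) z0.
Proof.
pose e y := \sum_j dd (axis k) (fun y => g y 0 j) y * N (Psi y) 0 j.
have e0 : dd (axis l) e y0 = 0.
  have -> : 0 = dd (axis l) (fun=> 0 : R) y0.
    by apply/esym/is_derive_ddE; exact: is_derive_cst.
  apply: dd_eq_line.
  have nD : \forall x \near x0, D (x, t) by apply: filterS near_domain_slice => x [].
  have nP : \forall x \near x0, D (x, t) /\
      dot (dd (axis k) g (x, t)) (N (Psi (x, t))) = 0.
    have no := near_orthogonal.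
    by near=> x; split; near: x; [exact: nD|apply: filterS no => x; apply].
  have := near_slice l nP; apply: filterS => h [x [-> [Dx E]]].
  by rewrite -[RHS]E; apply: eq_bigr => j _; rewrite dd_coord.
have dN j : is_derive y0 (axis l) (fun y => N (Psi y) 0 j)
    (- \sum_i gk l 0 i * dd (axis i) (dd (axis j) G) z0).
  have -> : (fun y => N (Psi y) 0 j) = cst (w 0 j) - (fun y => dd (axis j) G (Psi y)).
    by apply/funext => y; rewrite !mxE.
  have := is_deriveB (is_derive_cst (w 0 j) y0 (axis l))
    (is_derive_along_flow (axis l) (smooth_dd sG (axis j)) Dy0 OPsi0).
  rewrite sub0r /= -/(space _) (dd_space _ (smooth_dd sG (axis j)) OPsi0).
  move=> /is_derive_eq; apply; congr (- _).
  by apply: eq_bigr => i _; rewrite mxE.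
have de : is_derive y0 (axis l) e (\sum_j
   (gk k 0 j * (- \sum_i gk l 0 i * dd (axis i) (dd (axis j) G) z0) +
    N z0 0 j * dd (axis l) (dd (axis k) (fun y => g y 0 j)) y0)).
  apply: is_derive_bigsum => j.
  have := is_deriveM (is_derive_dd (smooth_dd (smooth_coord oD j sg) (axis k))
    (axis l) Dy0) (dN j).
  by rewrite dd_coord.
have := is_derive_ddE de; rewrite e0 big_split/= => /esym/eqP.
rewrite addrC addr_eq0 => /eqP ->; rewrite -sumrN.
by apply: eq_bigr => j _; rewrite mulrN opprK.
Unshelve. all: by end_near. Qed.

Hypotheses (T0 : 0 < T) (tT : 0 <= t <= T).
Hypothesis graph_time :
  \forall s \near t, 0 <= s <= T -> G (g (x0, s), s) = dot (g (x0, s)) w.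

(** Differentiates the graph identity in time and moves the transport term to the right. The
    identity holds for times in [[0, T]] only, hence the one-sided comparison. *)
Lemma vertical_speed :
  dd time G z0 = dot (dd time g y0) (N z0).
Proof.
have d1 := is_derive_time (is_derive_along_flow time sG Dy0 OPsi0).
have d2 := is_derive_time (dd_height time Dy0).
have : 'D_1 (fun s => G (Psi (x0, s))) t = 'D_1 (fun s => dot (g (x0, s)) w) t.
  apply: (derive_within_eq T0 tT); [exact: ex_derive|exact: ex_derive|exact: graph_time].
rewrite (@derive_val _ _ _ _ _ _ _ d1) (@derive_val _ _ _ _ _ _ _ d2) /=.
have -> : (dd time g y0, 1) = space (dd time g y0) + time :> 'rV[R]_n.+1 * R.
  by rewrite /space /time; congr pair; rewrite ?addr0 ?add0r.
rewrite (ddD sG _ _ OPsi0) (dd_space _ sG OPsi0) dotBr => <-.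
by rewrite addrAC subrr add0r.
Qed.

Let X x := g (x, t).

Let dX : differentiable X x0.
Proof.
apply: (@differentiable_comp _ _ _ _ (fun x : 'rV[R]_n => (x, t)) g).
  exact: dslice.
exact: smooth_differentiable sg Dy0.
Qed.

Lemma partialE k x : partial k X x = dd (axis k) g (x, t).
Proof. by rewrite -ddE; apply/esym; apply: derive_slice; near=> h.
Unshelve. all: by end_near. Qed.

Lemma partial2E k l j :
  (partial k (partial l X) x0) 0 j = dd (axis k) (dd (axis l) (fun y => g y 0 j)) y0.
Proof.
have -> : partial k (partial l X) x0 = dd (axis k) (dd (axis l) g) y0.
  rewrite -[in RHS]ddE; apply/esym; apply: derive_slice; near=> h.
  by rewrite partialE.
have sl : smooth D (dd (axis l) g) by rewrite -ddE; exact: smooth_derive.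
have -> : dd (axis k) (dd (axis l) (fun y => g y 0 j)) y0 =
    dd (axis k) (fun y => (dd (axis l) g y) 0 j) y0.
  by apply: (open_eq_dd _ oD) Dy0 => y Dy; exact: dd_coord.
rewrite -![dd (axis k) _]ddE derive_coord//; exact: smooth_differentiable sl Dy0.
Unshelve. all: by end_near. Qed.

Lemma partial_normal k : dot (N z0) (partial k X x0) = 0.
Proof. by rewrite partialE dotC; have := nbhs_singleton near_orthogonal; apply. Qed.

Lemma jacobian_normal : jacobian X x0 *m (N z0)^T = 0.
Proof.
apply/matrixP => k i; rewrite ord1 (jacobianE dX) [RHS]mxE -(partial_normal k) dotC mxE.
by apply: eq_bigr => j _; rewrite mxE [_^T _ _]mxE.
Qed.

(** Pairing the flow with [N] turns [H] into the trace of the Hessian of [G] against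
    [J^T *m Q *m J], the projection onto the tangent space, which is the identity minus
    [N^T *m N / |N|^2]. *)
Lemma graph_mcf_of_normal_speed : row_free (jacobian X x0) -> dot (N z0) (N z0) != 0 ->
  dd time g y0 = mean_curvature_vector X x0 -> graph_mcf w G z0.
Proof.
move=> Jf N0 speed; rewrite /graph_mcf vertical_speed speed -/(N z0).
set J := jacobian X x0 in Jf *; set Q := invmx (metric X x0).
have JE k i : J k i = gk k 0 i by rewrite /J (jacobianE dX) mxE -/(partial k X x0) partialE.
have sff k l : dot (normal_part X x0 (partial k (partial l X) x0)) (N z0) =
    \sum_j \sum_i J l j * J k i * dd (axis i) (dd (axis j) G) z0.
  rewrite (dot_normal_part _ jacobian_normal).
  transitivity (\sum_j N z0 0 j * dd (axis k) (dd (axis l) (fun y => g y 0 j)) y0).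
    by apply: eq_bigr => j _; rewrite partial2E mulrC.
  rewrite second_fundamental_form; apply: eq_bigr => j _; rewrite mulr_sumr.
  by apply: eq_bigr => i _; rewrite !JE mulrA.
have dot_sum (I : finType) (f : I -> 'rV[R]_n.+1) b :
    dot (\sum_k f k) b = \sum_k dot (f k) b.
  rewrite dot_mx mulmx_suml summxE.
  by apply: eq_bigr => k _; rewrite dot_mx.
have -> : dot (mean_curvature_vector X x0) (N z0) =
    \sum_i \sum_j (J^T *m Q *m J) i j * dd (axis i) (dd (axis j) G) z0.
  rewrite /mean_curvature_vector dot_sum.
  transitivity (\sum_k \sum_l \sum_j \sum_i
      Q k l * (J l j * J k i * dd (axis i) (dd (axis j) G) z0)).
    apply: eq_bigr => k _; rewrite dot_sum; apply: eq_bigr => l _.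
    rewrite dotZl sff mulr_sumr; apply: eq_bigr => j _; rewrite mulr_sumr.
    by [].
  rewrite reverse_sum4; apply: eq_bigr => i _; apply: eq_bigr => j _.
  rewrite [(J^T *m Q *m J) i j]mxE mulr_suml; apply: eq_bigr => l _.
  rewrite [(J^T *m Q) i l]mxE !mulr_suml.
  by apply: eq_bigr => k _; rewrite [J^T _ _]mxE; ring.
rewrite /Q /metric -/J (tangent_projection Jf jacobian_normal N0).
rewrite (dd2_space oO (N z0) sG OPsi0) /laplacian mulr_suml -sumrB.
apply: eq_bigr => i _.
have E (b : 'rV[R]_n.+1) c j : (1%:M - c *: (b^T *m b)) i j =
    (i == j)%:R - c * (b 0 i * b 0 j).
  by rewrite !mxE big_ord1 !mxE.
under eq_bigr do rewrite E mulrBl.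
rewrite sumrB; congr (_ - _).
  rewrite (bigD1 i)//= eqxx mul1r big1 ?addr0// => j ji.
  by rewrite eq_sym (negbTE ji) mul0r.
rewrite mulr_suml; apply: eq_bigr => j _.
by rewrite [RHS]mulrC [RHS]mulrA.
Qed.

End GraphicalFlow.

(** * Extension from the hyperplane, constant along its normal *)

Section HyperplaneProjection.
Context (R : realType) (m : nat) (w : 'rV[R]_m).
Hypothesis w1 : dot w w = 1.

Definition proj (y : 'rV[R]_m) : 'rV[R]_m := y - dot y w *: w.

Lemma proj_hyperplane y : hyperplane w (proj y).
Proof. by rewrite /hyperplane/= /proj dotBl dotZl w1 mulr1 subrr. Qed.

Lemma proj_vertical y a : hyperplane w y -> proj (y + a *: w) = y.
Proof.
by rewrite /hyperplane/= /proj dotDl dotZl w1 => ->; rewrite add0r mulr1 addrK.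
Qed.

Definition proj_time (z : 'rV[R]_m * R) : 'rV[R]_m * R := (proj z.1, z.2).

Lemma proj_time_linear : linear proj_time.
Proof.
move=> a [x s] [y r]; congr pair => /=.
rewrite /proj dotDl dotZl scalerDl scalerBr opprD scalerA.
by rewrite addrACA.
Qed.

Lemma continuous_dot : continuous (fun y : 'rV[R]_m => dot y w).
Proof.
have -> : (fun y : 'rV[R]_m => dot y w) = \sum_i (fun y : 'rV[R]_m => y 0 i * w 0 i).
  by apply/funext => y; rewrite fct_sumE.
elim/big_ind: _ => [|f g cf cg|i _]; first exact: (@cst_continuous _ _ (0 : R)).
  by move=> y; apply: continuousD; [exact: cf|exact: cg].
move=> y; apply: continuousM; first exact: coord_continuous.
exact: cst_continuous.
Qed.

Lemma continuous_proj_time : continuous proj_time.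
Proof.
move=> z.
suff cp : (fun z : 'rV[R]_m * R => proj z.1) @ z --> nbhs (proj z.1).
  exact: (cvg_pair cp cvg_snd).
apply: (@continuous_comp _ _ _ fst proj); first exact: cvg_fst.
have cid : {for z.1, continuous (@id 'rV[R]_m)} := @cvg_id _ (nbhs z.1).
have cdw : {for z.1, continuous (fun y : 'rV[R]_m => dot y w *: w)}.
  by apply: continuousZr_tmp; exact: continuous_dot.
exact: (continuousB cid cdw).
Qed.

Variables (D : set ('rV[R]_m * R)) (g : 'rV[R]_m * R -> R).
Hypotheses (oD : open D) (sg : smooth D g).

Lemma open_cylinder : open (proj_time @^-1` D).
Proof. by apply: open_comp => // z _; exact: continuous_proj_time. Qed.

Lemma smooth_cylinder : smooth (proj_time @^-1` D) (g \o proj_time).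
Proof.
pose l : {linear ('rV[R]_m * R)%type -> ('rV[R]_m * R)%type} :=
  HB.pack proj_time (GRing.isLinear.Build _ _ _ _ proj_time proj_time_linear).
exact: (@smooth_comp_lin _ _ _ _ l continuous_proj_time).
Qed.

Lemma cylinder_gradient z : D (proj_time z) ->
  dot w (gradient (g \o proj_time) z) = 0.
Proof.
move=> Dz; rewrite -(dd_space w smooth_cylinder)//.
rewrite -(is_derive_ddE (is_derive_cst (g (proj_time z)) z (space w))).
apply: dd_eq_line; near=> h; rewrite /cst /=; congr g.
rewrite /proj_time /space; congr pair => /=; last by rewrite scaler0 add0r.
by rewrite /proj dotDl dotZl w1 mulr1 scalerDl opprD addrACA subrr add0r.
Unshelve. all: by end_near. Qed.

End HyperplaneProjection.

Lemma dd_translate (R : realType) (V : normedModType R) (f : V -> R) c v :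
  (forall z, f (z + c) = f z) -> forall z, dd v f (z + c) = dd v f z.
Proof.
move=> fc z; rewrite -ddE derive_lineE [RHS]derive_lineE.
by under [in LHS]eq_fun do rewrite addrA fc.
Qed.

(** Used along [w], to carry the equation from a point of the hypersurface to the whole vertical
    line through it. *)
Lemma graph_mcf_translate (R : realType) m (w : 'rV[R]_m) G c z :
  (forall z, G (z + c) = G z) -> graph_mcf w G (z + c) -> graph_mcf w G z.
Proof.
move=> Gc; have d v := dd_translate v Gc; have d2 u v := dd_translate u (d v).
have gc : gradient G (z + c) = gradient G z.
  by apply/rowP => i; rewrite !mxE d.
rewrite /graph_mcf gc d d2 => ->; congr (_ - _).
by apply: eq_bigr => i _; rewrite d2.
Qed.

(** * Local solutions obtained from the flow *)

Section GraphicalMeanCurvatureFlow.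
Context (R : realType) (n : nat) (X : topologicalType).
Variables (A : smooth_manifold R n X) (w : 'rV[R]_n.+1) (T : R).
Variables (F : X -> R -> 'rV[R]_n.+1) (u : 'rV[R]_n.+1 -> R -> R).
Hypotheses (w1 : dot w w = 1) (T0 : 0 < T).
Hypotheses (mcf : mean_curvature_flow A T F) (graph : entire_graph w T F u).

(** Extends [u] constantly along [w], so that the height of the hypersurface can be evaluated at its
    own points. *)
Definition height (x : 'rV[R]_n.+1) (t : R) : R := u (proj w x) t.

Lemma height_flow p t : 0 <= t <= T -> dot (F p t) w = height (F p t) t.
Proof.
move=> tT; have [_ /(_ t tT) E] := graph.
have : range (fun p => F p t) (F p t) by exists p.
rewrite E => -[y yw Fp]; rewrite /height -Fp proj_vertical//.
by rewrite dotDl dotZl w1 mulr1 yw add0r.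
Qed.

Lemma flow_surjective x t : 0 <= t <= T -> exists p a, F p t = x + a *: w.
Proof.
move=> tT; have [_ /(_ t tT) E] := graph.
have : [set y + u y t *: w | y in hyperplane w] (proj w x + u (proj w x) t *: w).
  by exists (proj w x) => //; exact: proj_hyperplane.
rewrite -E => -[p _ Fp]; exists p, (u (proj w x) t - dot x w).
by rewrite Fp /proj scalerBl addrAC addrA.
Qed.

Section AtPoint.
Variables (O : set ('rV[R]_n.+1 * R)) (G : 'rV[R]_n.+1 * R -> R).
Hypotheses (oO : open O) (sG : smooth O G).
Hypothesis Gheight : forall z, O z -> 0 <= z.2 <= T -> G z = height z.1 z.2.
Hypothesis Gw : forall z, O z -> 0 <= z.2 <= T -> dot w (gradient G z) = 0.

Lemma slope_vector_gt0 z : O z -> 0 <= z.2 <= T ->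
  let N := w - gradient G z in dot N w = 1 /\ 0 < dot N N.
Proof.
move=> Oz zT N; have Nw : dot N w = 1.
  by rewrite /N dotBl w1 (dotC (gradient G z)) Gw// subr0.
split=> //; rewrite lt_def dot_ge0 andbT dot_eq0; apply/eqP => N0.
move: Nw; rewrite N0 -(scale0r (0 : 'rV[R]_n.+1)) dotZl mul0r => /eqP.
by rewrite eq_sym oner_eq0.
Qed.

(** Smoothness in the chart supplies an extension [g] of [F] to an open set. It agrees with [F] only
    over the chart image and for times in [[0, T]], so the graph identities are checked near the
    point under these restrictions. *)
Lemma flow_local p t (i : chart_index A) : 0 <= t <= T -> chart_dom i p -> O (F p t, t) ->
  (forall k,
    dot (w - gradient G (F p t, t)) (partial k (local_param F i t) (chart i p)) = 0) /\
  graph_mcf w G (F p t, t).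
Proof.
move=> tT ip Op; have [sF imF dF] := mcf.
set x0 := chart i p; have img0 : (chart i @` chart_dom i) x0 by exists p.
have [D [g [oD Dy0 sg gF]]] := sF i (x0, t) (conj img0 tT).
have gp s : D (x0, s) -> 0 <= s <= T -> g (x0, s) = F p s.
  move=> Ds sT; rewrite (gF (x0, s) (conj img0 sT) Ds) /local_param /=.
  by rewrite chartK.
have gp0 : g (x0, t) = F p t by exact: gp.
rewrite -gp0 in Op *.
have nD := near_domain oD sg oO Dy0 Op.
have nslice : \forall x \near x0,
    [/\ (chart i @` chart_dom i) x, D (x, t) & O (g (x, t), t)].
  have c : (x, t) @[x --> x0] --> (nbhs x0, nbhs t) :=
    cvg_pair (@cvg_id _ (nbhs x0)) (@cvg_cst _ t _ _ _).
  have nDx : \forall x \near x0, D (x, t) /\ O (g (x, t), t) by exact: c nD.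
  have nI : \forall x \near x0, (chart i @` chart_dom i) x.
    by apply: open_nbhs_nbhs; split=> //; exact: chart_img_open.
  by apply: filterS2 nI nDx => x ix [Dx Ox]; split.
have ntime : \forall s \near t, D (x0, s) /\ O (g (x0, s), s).
  have c : (x0, s) @[s --> t] --> (nbhs x0, nbhs t) :=
    cvg_pair (@cvg_cst _ x0 _ _ _) (@cvg_id _ (nbhs t)).
  exact: c nD.
have gheight x s : (chart i @` chart_dom i) x -> D (x, s) -> O (g (x, s), s) ->
    0 <= s <= T -> G (g (x, s), s) = dot (g (x, s)) w.
  move=> ix Dx Ox sT; rewrite Gheight// (gF (x, s) (conj ix sT) Dx) /local_param /=.
  by rewrite height_flow.
have graph_slice : \forall x \near x0, G (g (x, t), t) = dot (g (x, t)) w.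
  by apply: filterS nslice => x [ix Dx Ox]; exact: gheight.
have graph_time : \forall s \near t, 0 <= s <= T -> G (g (x0, s), s) = dot (g (x0, s)) w.
  by apply: filterS ntime => s [Ds Os]; exact: gheight.
have gX : \forall x \near x0, g (x, t) = local_param F i t x.
  by apply: filterS nslice => x [ix Dx _]; exact: (gF (x, t) (conj ix tT) Dx).
have dX : differentiable (fun x => g (x, t)) x0.
  apply: (@differentiable_comp _ _ _ _ (fun x : 'rV[R]_n => (x, t)) g).
    by apply: differentiable_pair; [exact: ex_diff|exact: differentiable_cst].
  exact: smooth_differentiable sg Dy0.
have [JE HE] := mean_curvature_near_eq gX dX (near_eq_differentiable gX dX).
(* [g] is smooth across the ends of the time interval, so its full time derivative is the one-sided
   limit in the flow equation. *)
have speed : dd time g (x0, t) = mean_curvature_vector (fun x => g (x, t)) x0.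
  have dg := is_derive_time (is_derive_diff time (smooth_differentiable sg Dy0)).
  rewrite HE -ddE -(@derive_val _ _ _ _ _ _ _ dg).
  apply: (derive_within T0 tT); first exact: ex_derive.
  apply: cvg_trans (dF i p t ip tT); apply: near_eq_cvg.
  rewrite /within /dnbhs/=; apply: filterS ntime => s [Ds _] _ /=.
  by rewrite in_itv => sT; rewrite gp0 gp.
have [_ N0] := slope_vector_gt0 Op tT.
split=> [k|].
  rewrite -(partial_normal oD sg oO sG Dy0 Op graph_slice k); congr (dot _ _).
  by apply: near_eq_derive; apply: filterS gX => x ->.
apply: (graph_mcf_of_normal_speed oD sg oO sG Dy0 Op graph_slice T0 tT
  graph_time _ _ speed).
  by rewrite JE; exact: imF.
by rewrite gt_eqF.
Qed.

End AtPoint.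

(** A smooth extension of [u] composed with the projection serves as [G]. Every vertical line meets
    the hypersurface; the equation holds there and is translated back along [w]. *)
Lemma flow_local_solution x t : 0 <= t <= T -> exists O G,
  local_solution w T height O G /\ O (x, t).
Proof.
move=> tT; have [su _] := graph.
have [D [g [oD Dx sg gu]]] := su (proj w x, t) (conj (proj_hyperplane w1 x) tT).
have oC := open_cylinder (w := w) oD; have sC := smooth_cylinder w oD sg.
have Gw z : D (proj_time w z) -> dot w (gradient (g \o proj_time w) z) = 0.
  by move=> Dz; exact: (cylinder_gradient w1 oD sg Dz).
have Gh z : D (proj_time w z) -> 0 <= z.2 <= T ->
    (g \o proj_time w) z = height z.1 z.2.
  by move=> Dz zT; apply: gu => //; split=> //; exact: proj_hyperplane.
exists (proj_time w @^-1` D), (g \o proj_time w); split=> //; split=> //.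
  by move=> z Dz _; exact: Gw.
move=> [y s] Dz /= sT; have [p [a Fp]] := flow_surjective y sT.
have [i ip] := chart_dom_cover A p.
have c_inv b z : proj_time w (z + space (b *: w)) = proj_time w z.
  rewrite /proj_time /space; congr pair => /=; last by rewrite addr0.
  by rewrite /proj dotDl dotZl w1 mulr1 scalerDl opprD addrACA subrr addr0.
apply: (@graph_mcf_translate _ _ _ _ (space (a *: w))) => [z|].
  by rewrite /= c_inv.
have E : (y, s) + space (a *: w) = (F p s, s).
  by rewrite Fp /space; congr pair; rewrite /= addr0.
rewrite E; apply: (flow_local oC sC Gh (fun z Dz _ => Gw z Dz) sT ip _).2.
by rewrite -E /= c_inv.
Qed.

End GraphicalMeanCurvatureFlow.

(** * The gradient estimate *)

(** [|h| < M] gives [(|h| - 2 M)^2 > M^2], so the exponent is at least [(18 M^2 + 4) / t]. The extra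
    factor [exp(4 / t) >= 4 / t] absorbs the prefactors, since [sqrt t >= t] for [t <= 1]. *)
Lemma sqrt_mul_exp_ge (R : realType) (M h t : R) :
  0 < M -> `|h| < M -> 0 < t -> t <= 1 ->
  2 * expR (18 * M ^+ 2 / t) <=
  Num.sqrt t * expR (4 * (18 * M ^+ 2 + 4) / M ^+ 2 * (`|h| - 2 * M) ^+ 2 / (4 * t)).
Proof.
move=> M0 hM t0 t1; have M20 : 0 < M ^+ 2 by rewrite exprn_gt0.
have le1 : expR ((18 * M ^+ 2 + 4) / t) <=
    expR (4 * (18 * M ^+ 2 + 4) / M ^+ 2 * (`|h| - 2 * M) ^+ 2 / (4 * t)).
  rewrite ler_expR.
  have -> : 4 * (18 * M ^+ 2 + 4) / M ^+ 2 * (`|h| - 2 * M) ^+ 2 / (4 * t) =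
    (18 * M ^+ 2 + 4) / t * ((`|h| - 2 * M) ^+ 2 / M ^+ 2).
    by field; rewrite !gt_eqF.
  rewrite ler_peMr//; first by rewrite divr_ge0 ?addr_ge0 ?mulr_ge0// ltW.
  have hM' : M <= 2 * M - `|h| by lra.
  rewrite ler_pdivlMr// mul1r -[X in _ <= X]sqrrN opprB ler_pXn2r// nnegrE.
    exact: ltW.
  exact: le_trans (ltW M0) hM'.
apply: le_trans (ler_wpM2l (sqrtr_ge0 t) le1).
have -> : (18 * M ^+ 2 + 4) / t = 4 / t + 18 * M ^+ 2 / t by rewrite -mulrDl addrC.
rewrite expRD [X in _ <= X]mulrA ler_pM2r ?expR_gt0//.
have st : t <= Num.sqrt t.
  rewrite -[X in X <= _](sqr_sqrtr (ltW t0)) expr2 ler_piMr ?sqrtr_ge0//.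
  by rewrite -sqrtr1 ler_wsqrtr.
have e4 : 4 / t <= expR (4 / t).
  by apply: le_trans (expR_ge1Dx _); rewrite lerDr.
have t4 : 0 <= 4 / t by rewrite divr_ge0// ltW.
apply: le_trans (ler_pM (ltW t0) t4 st e4).
by rewrite mulrCA divff ?gt_eqF//; lra.
Qed.

Theorem theorem9p2 (R : realType) (M : R) :
  exists c T' : R, [/\ 0 < c, 0 < T' &
    forall (n : nat) (X : topologicalType) (A : smooth_manifold R n X)
           (w : 'rV[R]_n.+1) (T : R) (F : X -> R -> 'rV[R]_n.+1)
           (u : 'rV[R]_n.+1 -> R -> R) (L : 'rV[R]_n.+1),
      dot w w = 1 ->
      0 < T ->
      mean_curvature_flow A T F ->
      entire_graph w T F u ->
      periodic_height w T u L ->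
      (forall y t, hyperplane w y -> 0 <= t <= T -> `|u y t| < M) ->
      forall (p : X) (t : R), 0 < t -> t <= T' -> t <= T ->
        exists2 nu : 'rV[R]_n.+1, upward_unit_normal A w F p t nu &
          (dot nu w)^-1 <=
            Num.sqrt t *
            expR (c * (`|dot (F p t) w| - 2 * M) ^+ 2 / (4 * t))].
Proof.
(* For [M <= 0] the height bound already fails at the origin, so any constants do. *)
have [M0|M0] := ltP 0 M; last first.
  exists 1, 1; split=> // n X A w T F u L w1 T0 _ _ _ uM p t _ _ _.
  have := uM _ 0 (proj_hyperplane w1 0); rewrite lexx ltW// => /(_ isT).
  by move=> /lt_le_trans /(_ M0); rewrite normr_lt0.
have M20 : 0 < M ^+ 2 by rewrite exprn_gt0.
(* The first constant is that of [sqrt_mul_exp_ge]; the time bound combines [t <= 6 * M ^+ 2] from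
   [slope_bound] with [t <= 1]. *)
exists (4 * (18 * M ^+ 2 + 4) / M ^+ 2), (Num.min (6 * M ^+ 2) 1); split.
- by rewrite divr_gt0// mulr_gt0// addr_gt0// mulr_gt0.
- by rewrite lt_min mulr_gt0//=.
move=> n X A w T F u L w1 T0 mcf graph _ uM p t t0; rewrite le_min => /andP[t6 t1] tT.
have tT' : 0 <= t <= T by rewrite ltW.
have hM x s : 0 <= s <= T -> `|height w u x s| < M.
  by move=> sT; apply: uM => //; exact: proj_hyperplane.
have loc := flow_local_solution w1 T0 mcf graph.
have [D [G [lG Dp]]] := loc (F p t) t tT'.
have [oD sG Gh Gw _] := lG.
have t0T : 0 < t <= T by rewrite t0.
have bound := slope_bound w1 hM loc lG Dp t0T t6.
set N := w - gradient G (F p t, t) in bound.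
have [Nw N0] := slope_vector_gt0 w1 Gw Dp tT'.
rewrite -/N in Nw N0.
have v0 : 0 < Num.sqrt (dot N N) by rewrite sqrtr_gt0.
have vw : dot ((Num.sqrt (dot N N))^-1 *: N) w = (Num.sqrt (dot N N))^-1.
  by rewrite dotZl Nw mulr1.
(* [N] is normal with [dot N w = 1], so the gradient function of the normalised vector is the length
   of [N]. *)
exists ((Num.sqrt (dot N N))^-1 *: N).
  split.
  - rewrite dotZl dotZr mulrA -invfM -expr2 sqr_sqrtr ?dot_ge0//.
    by rewrite mulVf// gt_eqF.
  - by rewrite vw invr_gt0.
  - move=> i k ip; rewrite dotZl.
    have [/(_ k) E _] := flow_local w1 T0 mcf graph oD sG Gh Gw tT' ip Dp.
    by rewrite [X in _ * X]E mulr0.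
rewrite vw invrK; apply: le_trans bound _.
apply: sqrt_mul_exp_ge => //.
by rewrite (height_flow w1 graph p tT'); exact: hM.
Qed.
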